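(* Let $(R,\mathfrak m)$ be a Noetherian local ring and $E$ a finitely generated $R$-module having rank $e\ge2$. Let $R''$, $E''$, the presentation matrix $\varphi$ of $E''$, its submatrices $\psi$ and $\rho$, and generic Bourbaki ideals be as in the context. If $\operatorname{grade}F_e(E)\ge2$, then $$I\simeq I_{n-e}(\psi)\subseteq I_{n-e}(\rho)\subseteq F_e(E''),$$ with $I_{n-e}(\rho)\simeq[[E'']]_{R''}\simeq\det\nolimits_0(E)\cdot R''$, for any generic Bourbaki ideal $I$ of $E$. If moreover $\operatorname{proj\,dim}E=1$, then $$I\simeq I_{n-e}(\psi)\subseteq I_{n-e}(\rho)=F_e(E'')$$ for any generic Bourbaki ideal $I$ of $E$.
   Context: A finitely generated module $E$ over a Noetherian ring $R$ with total ring of fractions $Q$ has rank $e$ if $E\otimes_RQ\simeq Q^e$. $\tau_R(M)$ is the $R$-torsion submodule of $M$, i.e. the submodule of elements killed by a non-zero-divisor of $R$. The Rees algebra is $\mathcal R(E)=\mathcal S(E)/\tau_R(\mathcal S(E))$, with $\mathcal S(E)$ the symmetric algebra; a submodule $U\subseteq E$ is a reduction of $E$ if $\mathcal R(E)_{s+1}=(U/\tau_R(U))\cdot\mathcal R(E)_s$ for some $s\ge0$ (e.g. $U=E$). $I_t(\cdot)$ is the ideal generated by the $t\times t$ minors; the Fitting ideal $F_i(M)$ is $I_{p-i}(\varphi_0)$ for any finite presentation matrix $\varphi_0$ of $M$ with respect to $p$ generators. Order determinant: for an $R$-homomorphism $f\colon E\to R^e$ whose image has rank $e$, $\det_0(E)=\det_f(E)\subseteq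 R$ is the ideal given by the image of $\bigwedge^ef\colon\bigwedge^eE\to\bigwedge^eR^e\simeq R$ (up to isomorphism independent of $f$). Norm: $[[E]]_R$ is the fractional ideal $\operatorname{im}\big(\bigwedge^eE\to\bigwedge^eE\otimes_RQ\simeq Q\big)$, considered up to isomorphism; $[[E'']]_{R''}$ is defined in the same way over $R''$. Construction: let $U=\sum_{i=1}^rRa_i$ be a reduction of $E$, let $\mathbf Z=\{z_{ij}\mid1\le i\le r,\ 1\le j\le e-1\}$ be indeterminates over $R$, $R'=R[\mathbf Z]$, $R''=R'_{\mathfrak mR'}$ (Nagata extension), $E''=E\otimes_RR''$, $x_j=\sum_iz_{ij}a_i\in E''$ for $1\le j\le e-1$, and $F=\sum_{j=1}^{e-1}R''x_j$, a free $R''$-module with basis $x_1,\dots,x_{e-1}$. An ideal $I\subseteq R''$ isomorphic to $E''/F$ is a generic Bourbaki ideal of $E$ (with respect to $U$). Let $\{x_1,\dots,x_n\}$ be a generating set of $E''$ containing $x_1,\dots,x_{e-1}$, and let ${R''}^m\xrightarrow{\varphi}{R''}^n\to E''\to0$ be a finite free presentation with respect to these generators, $\varphi$ also denoting the $n\times m$ relation matrix. Let $\psi$ be an $(n-e+1)\times(n-e)$ submatrix of $\varphi$, with rows $e,\dots,n$, satisfying $\operatorname{grade}I_{n-e}(\psi)\ge1$, and let $\rho$ be the $n\times(n-e)$ submatrix of $\varphi$ containing $\psi$ (the same columns, all rows).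
   Formalization: In the ''moreover'' part the relation matrix φ is also assumed irredundant (no column is a linear combination of the others); for a redundant φ, e.g. φ = [v | xv] with ρ = xv, the equality I_{n-e}(ρ) = F_e(E'') fails. *)

(* Defs.v *)
(* Ideals and submodules are Prop-valued predicates.  Localizations, scalar
   extensions, symmetric algebras and exterior powers, which the libraries do
   not provide, are specified by their defining properties; they are thereby
   determined up to unique isomorphism, and every statement below is about an
   arbitrary model of them. *)
From mathcomp Require Import all_boot all_algebra.
From mathcomp Require Export mpoly.
Set Implicit Arguments.
Unset Strict Implicit.
Unset Printing Implicit Defensive.
Import GRing.Theory.
Local Open Scope ring_scope.

(** * Submodules and ideals *)

Definition submodule (R : comNzRingType) (M : lmodType R) (N : M -> Prop) :=
  N 0 /\ forall (c : R) (x y : M), N x -> N y -> N (c *: x + y).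

Definition lspan (R : comNzRingType) (M : lmodType R) (X : M -> Prop) :
    M -> Prop := fun u =>
  exists (n : nat) (c : 'I_n -> R) (x : 'I_n -> M),
    (forall i, X (x i)) /\ u = \sum_i c i *: x i.

Definition fam_span (R : comNzRingType) (M : lmodType R) (n : nat)
    (x : 'I_n -> M) : M -> Prop :=
  lspan (fun u => exists i, u = x i).

Definition finitely_generated (R : comNzRingType) (M : lmodType R) :=
  exists (n : nat) (x : 'I_n -> M), forall u, fam_span x u.

Definition free_family (R : comNzRingType) (M : lmodType R) (n : nat)
    (x : 'I_n -> M) :=
  forall c : 'I_n -> R, \sum_i c i *: x i = 0 -> forall i, c i = 0.

Definition is_ideal (R : comNzRingType) (I : R -> Prop) :=
  @submodule R R^o I.

Definition ideal_gen (R : comNzRingType) (X : R -> Prop) : R -> Prop :=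
  @lspan R R^o X.

Definition ext_ideal (A B : comNzRingType) (f : A -> B) (I : A -> Prop) :
    B -> Prop :=
  ideal_gen (fun y => exists2 x, I x & y = f x).

Definition subset_of (T : Type) (I J : T -> Prop) := forall x, I x -> J x.

(* An R-linear isomorphism between two submodules; the values of f outside A
   are irrelevant. *)
Definition submod_iso (R : comNzRingType) (M N : lmodType R)
    (A : M -> Prop) (B : N -> Prop) :=
  exists f : M -> N,
    [/\ forall x, A x -> B (f x),
        forall (c : R) (x y : M), A x -> A y ->
          f (c *: x + y) = c *: f x + f y,
        forall x y, A x -> A y -> f x = f y -> x = y
      & forall z, B z -> exists2 x, A x & f x = z].

Definition noetherian (R : comNzRingType) :=
  forall I : R -> Prop, is_ideal I ->
    exists (n : nat) (a : 'I_n -> R),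
      forall x, I x <-> @fam_span R R^o n a x.

Definition maximal_ideal (R : comNzRingType) (m : R -> Prop) :=
  [/\ is_ideal m, ~ m 1
    & forall J : R -> Prop, is_ideal J -> subset_of m J -> ~ J 1 ->
        subset_of J m].

Definition local_ring (R : comNzRingType) (m : R -> Prop) :=
  maximal_ideal m /\
  forall m' : R -> Prop, maximal_ideal m' -> forall x, m' x <-> m x.

(** * Torsion and grade *)

Definition nonzerodivisor (R : comNzRingType) (s : R) :=
  forall y : R, s * y = 0 -> y = 0.

Definition torsion (R : comNzRingType) (M : lmodType R) (u : M) :=
  exists2 s : R, nonzerodivisor s & s *: u = 0.

Definition regular_sequence (R : comNzRingType) (t : nat) (a : 'I_t -> R) :=
  (forall (i : 'I_t) (y : R),
     let J := ideal_gen (fun z => exists2 j : 'I_t, (j < i)%N & z = a j) in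
     J (a i * y) -> J y)
  /\ ~ @fam_span R R^o t a 1.

(* The unit ideal has infinite grade. *)
Definition grade_ge (R : comNzRingType) (I : R -> Prop) (t : nat) :=
  I 1 \/ exists a : 'I_t -> R, regular_sequence a /\ forall i, I (a i).

(** * Localization, extension of scalars, rank *)

Definition is_localization (A B : comNzRingType) (S : A -> Prop)
    (f : {rmorphism A -> B}) :=
  [/\ forall s, S s -> exists t : B, f s * t = 1,
      forall b : B, exists (x s : A), S s /\ f s * b = f x
    & forall x : A, f x = 0 -> exists2 s, S s & s * x = 0].

Definition total_ring_of_fractions (R : comNzRingType) (Q : comAlgType R) :=
  is_localization (@nonzerodivisor R) (GRing.in_alg Q).

(* b : M -> N exhibits N as the tensor product of M and B over A: it is
   universal among the A-linear maps from M to B-modules. *)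
Definition is_base_change (A B : comNzRingType) (f : {rmorphism A -> B})
    (M : lmodType A) (N : lmodType B) (b : {linear M -> N | f \; *:%R}) :=
  forall (P : lmodType B) (g : {linear M -> P | f \; *:%R}),
    exists2 h : {linear N -> P}, (forall u, h (b u) = g u)
      & forall h' : {linear N -> P}, (forall u, h' (b u) = g u) ->
          forall v, h' v = h v.

Definition has_rank (R : comNzRingType) (M : lmodType R) (e : nat) :=
  exists (Q : comAlgType R) (MQ : lmodType Q)
         (b : {linear M -> MQ | GRing.in_alg Q \; *:%R}),
    [/\ total_ring_of_fractions Q, is_base_change b
      & exists h : {linear MQ -> 'rV[Q]_e}, bijective h].

(** * Symmetric algebra, Rees algebra, reductions *)

Definition is_symmetric_algebra (R : comNzRingType) (E : lmodType R)
    (S : comAlgType R) (i : {linear E -> S}) :=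
  forall (A : comAlgType R) (g : {linear E -> A}),
    exists2 h : {lrmorphism S -> A}, (forall u, h (i u) = g u)
      & forall h' : {lrmorphism S -> A}, (forall u, h' (i u) = g u) ->
          forall v, h' v = h v.

(* The algebra A is the quotient of the symmetric algebra of E by its
   R-torsion, and j is the canonical map from E to the degree 1 part of A. *)
Definition is_rees_algebra (R : comNzRingType) (E : lmodType R)
    (A : comAlgType R) (j : E -> A) :=
  exists (S : comAlgType R) (i : {linear E -> S}) (p : {lrmorphism S -> A}),
    [/\ is_symmetric_algebra i,
        forall y : A, exists x : S, p x = y,
        forall x : S, p x = 0 <-> torsion x
      & forall u : E, j u = p (i u)].

Definition rees_piece (R : comNzRingType) (E : lmodType R)
    (A : comAlgType R) (j : E -> A) (s : nat) : A -> Prop :=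
  lspan (fun y => exists v : 'I_s -> E, y = \prod_i j (v i)).

(* The image of U in degree 1 is the quotient of U by its torsion. *)
Definition is_reduction (R : comNzRingType) (E : lmodType R)
    (U : E -> Prop) :=
  submodule U /\
  exists (A : comAlgType R) (j : E -> A), is_rees_algebra j /\
    exists s : nat, forall y : A,
      rees_piece j s.+1 y <->
      lspan (fun z => exists u x, [/\ U u, rees_piece j s x & z = j u * x]) y.

(** * Minors, presentations, Fitting ideals *)

(* Row and column selections are arbitrary functions: a repetition gives 0 and
   a reordering changes the sign, so the ideal is that of the t x t minors. *)
Definition minors_ideal (R : comNzRingType) (p q : nat) (t : nat)
    (A : 'M[R]_(p, q)) : R -> Prop :=
  ideal_gen (fun x => exists (f : 'I_t -> 'I_p) (g : 'I_t -> 'I_q),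
    x = \det (mxsub f g A)).

(* Exactness of R^q -> R^p -> M -> 0 for the map given by A on columns. *)
Definition is_presentation (R : comNzRingType) (M : lmodType R) (p q : nat)
    (x : 'I_p -> M) (A : 'M[R]_(p, q)) :=
  (forall u : M, fam_span x u) /\
  forall c : 'cV[R]_p,
    \sum_i c i 0 *: x i = 0 <-> exists v : 'cV[R]_q, c = A *m v.

(* When p <= i, truncated subtraction gives the 0 x 0 minors, hence R. *)
Definition fitting_ideal (R : comNzRingType) (M : lmodType R) (i : nat) :
    R -> Prop := fun y =>
  exists (p q : nat) (x : 'I_p -> M) (A : 'M[R]_(p, q)),
    is_presentation x A /\ minors_ideal (p - i) A y.

(* The columns irredundantly generate their span: none of them is a linear
   combination of the others.  Fitting ideals do not depend on the presentation,
   but the minors of a choice of columns do: if some columns are repeated after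
   multiplication by a non-unit, the selected columns may fail to generate all
   relations, although their maximal minors have positive grade. *)
Definition minimal_columns (R : comNzRingType) (p q : nat)
    (A : 'M[R]_(p, q)) :=
  forall j : 'I_q, ~ exists v : 'cV[R]_q, v j 0 = 0 /\ col j A = A *m v.

(** * Projective dimension *)

Definition projective (R : comNzRingType) (P : lmodType R) :=
  forall (M N : lmodType R) (g : {linear M -> N}) (h : {linear P -> N}),
    (forall y, exists x, g x = y) ->
    exists h' : {linear P -> M}, forall u, g (h' u) = h u.

Fixpoint projdim_le (R : comNzRingType) (M : lmodType R) (d : nat) : Prop :=
  if d is d'.+1 then
    exists (P K : lmodType R) (i : {linear K -> P}) (p : {linear P -> M}),
      [/\ projective P, injective i, forall y, exists x, p x = y,
          forall x, p x = 0 <-> exists z, i z = x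
        & projdim_le K d']
  else projective M.

Definition projdim_eq (R : comNzRingType) (M : lmodType R) (d : nat) :=
  projdim_le M d /\ forall d', (d' < d)%N -> ~ projdim_le M d'.

(** * Exterior powers, order determinant, norm *)

Definition multilinear (R : comNzRingType) (M L : lmodType R) (e : nat)
    (w : {ffun 'I_e -> M} -> L) :=
  forall (i : 'I_e) (v : {ffun 'I_e -> M}) (c : R) (y z : M),
    let upd u := [ffun j => if j == i then u else v j] in
    w (upd (c *: y + z)) = c *: w (upd y) + w (upd z).

Definition alternating (R : comNzRingType) (M L : lmodType R) (e : nat)
    (w : {ffun 'I_e -> M} -> L) :=
  multilinear w /\
  forall (v : {ffun 'I_e -> M}) (i j : 'I_e), i != j -> v i = v j -> w v = 0.

Definition is_exterior_power (R : comNzRingType) (M L : lmodType R) (e : nat)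
    (w : {ffun 'I_e -> M} -> L) :=
  alternating w /\
  forall (P : lmodType R) (g : {ffun 'I_e -> M} -> P), alternating g ->
    exists2 h : {linear L -> P}, (forall v, h (w v) = g v)
      & forall h' : {linear L -> P}, (forall v, h' (w v) = g v) ->
          forall l, h' l = h l.

Definition image_has_rank (R : comNzRingType) (M N : lmodType R)
    (f : {linear M -> N}) (e : nat) :=
  exists (T : lmodType R) (p : {linear M -> T}) (i : {linear T -> N}),
    [/\ forall y, exists x, p x = y, injective i,
        forall u, f u = i (p u) & has_rank T e].

(* D is the image in R of the e-th exterior power F of f, the e-th exterior
   power P of R^e being identified with R by some isomorphism theta. *)
Definition is_order_determinant (R : comNzRingType) (E : lmodType R)
    (e : nat) (f : {linear E -> 'rV[R]_e}) (D : R -> Prop) :=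
  image_has_rank f e /\
  exists (L P : lmodType R) (w : {ffun 'I_e -> E} -> L)
         (w' : {ffun 'I_e -> 'rV[R]_e} -> P)
         (F : {linear L -> P}) (theta : {linear P -> R^o}),
    [/\ is_exterior_power w, is_exterior_power w',
        forall v : {ffun 'I_e -> E}, F (w v) = w' [ffun i => f (v i)],
        bijective theta
      & forall x : R, D x <-> exists l : L, theta (F l) = x].

(* N is the image in Q of the e-th exterior power L of E, the extension LQ of
   L to Q being identified with Q by some isomorphism theta. *)
Definition is_norm (R : comNzRingType) (E : lmodType R) (e : nat)
    (Q : comAlgType R) (N : Q -> Prop) :=
  exists (L : lmodType R) (w : {ffun 'I_e -> E} -> L)
         (LQ : lmodType Q) (b : {linear L -> LQ | GRing.in_alg Q \; *:%R})
         (theta : {linear LQ -> Q^o}),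
    [/\ is_exterior_power w, is_base_change b, bijective theta
      & forall x : Q, N x <-> exists l : L, theta (b l) = x].

(** * Nagata extension and generic Bourbaki ideals *)

(* The base ring R'' is the localization of R' = R[Z] at the prime ideal m R'. *)
Definition is_nagata_extension (R : comNzRingType) (m : R -> Prop) (N : nat)
    (R2 : comNzRingType) (iota : {rmorphism {mpoly R[N]} -> R2}) :=
  is_localization (fun p => ~ ext_ideal (@mpolyC N R) m p) iota.

Definition nagata_incl (R : comNzRingType) (N : nat) (R2 : comNzRingType)
    (iota : {rmorphism {mpoly R[N]} -> R2}) : {rmorphism R -> R2} :=
  (iota \o @mpolyC N R)%FUN.

(* The element x_j = sum_i z_ij a_i, where the indeterminates z_ij, with
   i < r and j < e - 1, are numbered by mxvec_index. *)
Definition generic_element (R : comNzRingType) (E : lmodType R) (r d : nat)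
    (a : 'I_r -> E) (R2 : comNzRingType)
    (iota : {rmorphism {mpoly R[r * d]} -> R2}) (E2 : lmodType R2)
    (b : E -> E2) (j : 'I_d) : E2 :=
  \sum_(i < r) iota 'X_(mxvec_index i j) *: b (a i).

(* I is an ideal isomorphic to E2/F, where F is free with basis x; the map p
   exhibits C as the quotient of E2 by F. *)
Definition is_bourbaki_ideal (S : comNzRingType) (E2 : lmodType S) (d : nat)
    (x : 'I_d -> E2) (I : S -> Prop) :=
  [/\ free_family x, is_ideal I
    & exists (C : lmodType S) (p : {linear E2 -> C}),
        [/\ forall y, exists u, p u = y,
            forall u, p u = 0 <-> fam_span x u
          & @submod_iso S C S^o (fun _ => True) I]].

(* Main.v *)
Require Import Defs.
From HB Require Import structures.
From mathcomp Require Import all_boot all_algebra perm boolp ring.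
Set Implicit Arguments.
Unset Strict Implicit.
Unset Printing Implicit Defensive.
Import GRing.Theory.
Local Open Scope ring_scope.

(* Up to a non-zero-divisor s, E is R^e: there are f : E -> R^e and u : R^e -> E
   with f u = s and u f = s, and these data survive the flat extension R -> R''.
   With P the matrix of f on the generators of E'' and S the coordinates of u,
   P S = s and P phi = 0, hence s^e det (rho_f) = det [S | rho] det [P ; 1_f] for
   every choice f of k rows.  So I_k(rho) is proportional to I_e(P), and so are
   the norm and the order determinant, since an alternating form on E is
   determined by its value on u up to s^e; moreover the (k+1)-minors of phi vanish.
   Thus the signed minors of psi kill the relations of E''/F; their kernel is
   torsion modulo the columns of psi, whereas E''/F, being isomorphic to an ideal,
   is torsion free, so that E''/F is isomorphic to I_k(psi).
   If E has projective dimension 1, the column space of phi is projective over the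
   local ring R'', hence free on the irredundant columns of phi, which number k.
   For another presentation A of E'', the matrix [S | rho] presents E'' / <u>, in
   which the columns of [S' | A_g] are relations, so that det [S | rho] divides
   det [S' | A_g], which gives I_{p-e}(A) in I_k(rho). *)

(** The models of tensor products and exterior powers are given by properties of maps, not of
    elements. That N is generated by the image of M, or has no relations beyond the extended ones,
    is recovered by testing the universal property on quotient modules. The proportionality factors
    s^e and beta are non-zero-divisors but seldom units, so the isomorphisms between ideals are
    divisions that no formula in R expresses; they are produced from linear relations such as s^e y
    = beta d. Counting columns and recognizing non-zero-divisors both rest on McCoy's theorem: over
    any commutative ring, a matrix with trivial kernel and q columns has no nonzero element
    annihilating all its t-minors, for t <= q. Flatness of R -> R'' enters as the transfer of
    implications M v = 0 -> N v = 0 between linear systems. Projectivity of the module of relations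
    is encoded by a matrix eps so that it takes this form: one matrix equation and one such
    implication, which both pass to R''. *)

(** * Quotient modules, linear maps and spans *)

Section QuotientModule.
Local Open Scope quotient_scope.
Variables (R : comNzRingType) (V : lmodType R) (N : V -> Prop).
Hypothesis subN : submodule N.

(** The proof that N is a submodule is a phantom argument, on which the closedness instance below
    depends. *)
Definition submodule_pred of submodule N : {pred V} := fun v => `[< N v >].

Lemma submodule_pred_zmod : zmod_closed (submodule_pred subN).
Proof.
have [N0 NZ] := subN; split; first exact/asboolP.
move=> u v /asboolP Nu /asboolP Nv; apply/asboolP.
by rewrite addrC -scaleN1r; apply: NZ.
Qed.

HB.instance Definition _ :=
  GRing.isZmodClosed.Build V (submodule_pred subN) submodule_pred_zmod.

Definition lquot := Quotient.quot (submodule_pred subN).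
HB.instance Definition _ := GRing.Zmodule.on lquot.

Definition lquot_pi (v : V) : lquot := \pi_(Quotient.quot (submodule_pred subN)) v.

Lemma lquot_piE u v : lquot_pi u = lquot_pi v <-> N (u - v).
Proof.
have -> : (lquot_pi u = lquot_pi v) <-> (lquot_pi u == lquot_pi v).
  by split=> /eqP.
by rewrite -Quotient.idealrBE; split=> /asboolP.
Qed.

Lemma lquot_piD u v : lquot_pi (u + v) = lquot_pi u + lquot_pi v.
Proof. exact: Quotient.pi_add. Qed.

Definition lquot_scale (c : R) (z : lquot) : lquot :=
  lquot_pi (c *: repr (z : Quotient.quot (submodule_pred subN))).

Lemma lquot_scale_pi c v : lquot_scale c (lquot_pi v) = lquot_pi (c *: v).
Proof.
apply/lquot_piE; rewrite -scalerBr -[_ *: _]addr0.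
case: (subN) => N0 NZ; apply: (NZ) => //; apply/lquot_piE.
exact: reprK.
Qed.

Lemma lquot_piP z : exists v, z = lquot_pi v.
Proof. by exists (repr (z : Quotient.quot (submodule_pred subN))); rewrite /lquot_pi reprK. Qed.

Lemma lquot_scaleA a b z : lquot_scale a (lquot_scale b z) = lquot_scale (a * b) z.
Proof. by case: (lquot_piP z) => v ->; rewrite !lquot_scale_pi scalerA. Qed.

Lemma lquot_scale1 : left_id 1 lquot_scale.
Proof. by move=> z; case: (lquot_piP z) => v ->; rewrite lquot_scale_pi scale1r. Qed.

Lemma lquot_scaleDr : right_distributive lquot_scale +%R.
Proof.
move=> a y z; case: (lquot_piP y) (lquot_piP z) => [u ->] [v ->].
by rewrite -lquot_piD !lquot_scale_pi scalerDr lquot_piD.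
Qed.

Lemma lquot_scaleDl z : {morph lquot_scale^~ z : a b / a + b}.
Proof.
move=> a b; case: (lquot_piP z) => v -> /=.
by rewrite !lquot_scale_pi scalerDl lquot_piD.
Qed.

HB.instance Definition _ := GRing.Zmodule_isLmodule.Build R lquot
  lquot_scaleA lquot_scale1 lquot_scaleDr lquot_scaleDl.

Lemma lquot_pi_linear : linear lquot_pi.
Proof. by move=> c u v; rewrite lquot_piD -lquot_scale_pi. Qed.

HB.instance Definition _ := GRing.isLinear.Build R V lquot *:%R lquot_pi lquot_pi_linear.

Lemma quotient_module : exists (C : lmodType R) (p : {linear V -> C}),
  (forall z, exists v, p v = z) /\ (forall v, p v = 0 <-> N v).
Proof.
exists lquot, (lquot_pi : {linear V -> lquot}); split=> [z|v].
  by case: (lquot_piP z) => v ->; exists v.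
by rewrite -[0](linear0 lquot_pi) lquot_piE subr0.
Qed.

End QuotientModule.

Section SemilinearMap.
Variables (A B : comNzRingType) (f : {rmorphism A -> B}).
Variables (M : lmodType A) (N : lmodType B) (g : M -> N).
Hypothesis g_lin : forall c u v, g (c *: u + v) = f c *: g u + g v.

Lemma semilinear_map : exists h : {linear M -> N | f \; *:%R}, h =1 g.
Proof.
pose m := GRing.isLinear.Build A M N (f \; *:%R) g g_lin.
pose h : {linear M -> N | f \; *:%R} := HB.pack g m.
by exists h.
Qed.

End SemilinearMap.

Lemma linear_map (R : comNzRingType) (M N : lmodType R) (g : M -> N) :
    (forall c u v, g (c *: u + v) = c *: g u + g v) ->
  exists h : {linear M -> N}, h =1 g.
Proof.
move=> g_lin; pose m := GRing.isLinear.Build R M N *:%R g g_lin.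
by pose h : {linear M -> N} := HB.pack g m; exists h.
Qed.

Section Spans.
Variables (R : comNzRingType) (M : lmodType R).

Lemma submoduleD (N : M -> Prop) u v : submodule N -> N u -> N v -> N (u + v).
Proof. by case=> _ NZ Nu Nv; rewrite -[u]scale1r; apply: NZ. Qed.

Lemma submoduleZ (N : M -> Prop) c u : submodule N -> N u -> N (c *: u).
Proof. by case=> N0 NZ Nu; rewrite -[_ *: _]addr0; apply: NZ. Qed.

Lemma submodule_sum (N : M -> Prop) (I : Type) (r : seq I) (P : pred I) (F : I -> M) :
  submodule N -> (forall i, P i -> N (F i)) -> N (\sum_(i <- r | P i) F i).
Proof.
move=> subN NF; apply: (big_ind N) => //; first by case: subN.
by move=> u v; apply: submoduleD.
Qed.

Lemma lspan_submodule (X : M -> Prop) : submodule (lspan X).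
Proof.
split; first by exists 0, (fun _ => 0), (fun _ => 0); rewrite big_ord0; split=> // -[].
move=> c u v [n1 [c1 [x1 [X1 ->]]]] [n2 [c2 [x2 [X2 ->]]]].
exists (n1 + n2)%N, (fun i => match split i with inl j => c * c1 j | inr j => c2 j end).
exists (fun i => match split i with inl j => x1 j | inr j => x2 j end).
split=> [i|]; first by case: split.
rewrite big_split_ord /= scaler_sumr; congr (_ + _); apply: eq_bigr => i _.
  by rewrite (unsplitK (inl i)) scalerA.
by rewrite (unsplitK (inr i)).
Qed.

Lemma lspan_min (X N : M -> Prop) :
  submodule N -> (forall u, X u -> N u) -> forall u, lspan X u -> N u.
Proof.
move=> subN XN u [n [c [x [Xx ->]]]]; apply: submodule_sum => // i _.
by apply: submoduleZ => //; apply: XN.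
Qed.

Lemma lspan_mem (X : M -> Prop) u : X u -> lspan X u.
Proof. by move=> Xu; exists 1%N, (fun _ => 1), (fun _ => u); rewrite big_ord1 scale1r. Qed.

Lemma fam_spanP n (x : 'I_n -> M) u :
  fam_span x u <-> exists c : 'I_n -> R, u = \sum_i c i *: x i.
Proof.
split=> [|[c ->]]; last by exists n, c, x; split=> // i; exists i.
move: u; apply: lspan_min => [|_ [i ->]].
  split=> [|c u v [a ->] [b ->]].
    by exists (fun _ => 0); rewrite big1 // => i _; rewrite scale0r.
  exists (fun i => c * a i + b i); rewrite scaler_sumr -big_split /=.
  by apply: eq_bigr => i _; rewrite scalerDl scalerA.
exists (fun j => (j == i)%:R); rewrite (bigD1 i) //= eqxx scale1r big1 ?addr0 //.
by move=> j /negPf->; rewrite scale0r.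
Qed.

End Spans.

(** * Generators and relations after extension of scalars *)

Section BaseChange.
Variables (A B : comNzRingType) (f : {rmorphism A -> B}).
Variables (M : lmodType A) (N : lmodType B) (b : {linear M -> N | f \; *:%R}).
Hypothesis bcN : is_base_change b.

Lemma base_change_eq (P : lmodType B) (h1 h2 : {linear N -> P}) :
  (forall u, h1 (b u) = h2 (b u)) -> h1 =1 h2.
Proof.
move=> eq_h v; have [|g gE] := @semilinear_map _ _ f M P (h2 \o b).
  by move=> c u w /=; rewrite !linearP.
have [h _ hU] := bcN g.
by rewrite (hU h1) ?(hU h2) // => u; rewrite gE.
Qed.

(** The quotient map by N' and the zero map agree on the image of [b], hence everywhere by
    uniqueness. *)
Lemma base_change_ind (N' : N -> Prop) :
  submodule N' -> (forall u, N' (b u)) -> forall v, N' v.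
Proof.
move=> subN' N'b v; have [C [p [_ pE]]] := quotient_module subN'.
have [|z zE] := @linear_map B N C (fun _ => 0); first by move=> *; rewrite scaler0 addr0.
apply/pE; rewrite -[RHS](zE v); apply: base_change_eq => u.
by rewrite zE; apply/pE.
Qed.

Variables (p : nat) (y : 'I_p -> M).
Hypothesis y_gen : forall u, fam_span y u.

Lemma base_change_gen v : fam_span (b \o y) v.
Proof.
move: v; apply: base_change_ind; first exact: lspan_submodule.
move=> u; have /fam_spanP [c ->] := y_gen u; apply/fam_spanP.
exists (f \o c); rewrite linear_sum; apply: eq_bigr => i _.
by rewrite linearZ_LR.
Qed.

(** Right exactness of the tensor product, from the universal property alone. Sending an element of
    M to the class of its coordinates in B^p modulo the extended relations is semilinear; the
    induced map on N sends the given relation to the class of c, which is therefore 0. *)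
Lemma base_change_rel (c : 'cV[B]_p) :
  \sum_j c j 0 *: b (y j) = 0 ->
  lspan (fun z => exists2 r : 'cV[A]_p, \sum_j r j 0 *: y j = 0 & z = map_mx f r) c.
Proof.
set X := lspan _; have subX : submodule X := lspan_submodule _.
have [C [pi [_ piE]]] := quotient_module subX.
have ex_r u : exists r : 'cV[A]_p, \sum_j r j 0 *: y j = u.
  have /fam_spanP [r ->] := y_gen u.
  by exists (\col_j r j); apply: eq_bigr => j _; rewrite mxE.
have [r rE] := choice ex_r.
(* [r] chooses coordinates; [gE] shows that the choice does not matter modulo X. *)
pose g u := pi (map_mx f (r u)).
have gE (s : 'cV_p) : g (\sum_j s j 0 *: y j) = pi (map_mx f s).
  apply/eqP; rewrite -subr_eq0 -raddfB -raddfB; apply/eqP/piE/lspan_mem.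
  set u := \sum_j _; exists (r u - s) => //.
  transitivity (\sum_j (r u j 0 *: y j - s j 0 *: y j)); last by rewrite sumrB rE subrr.
  by apply: eq_bigr => j _; rewrite !mxE scalerBl.
have [|G GE] := @semilinear_map _ _ f M C g.
  move=> a u v; rewrite -{1}(rE u) -{1}(rE v).
  transitivity (g (\sum_j (a *: r u + r v) j 0 *: y j)).
    congr g; rewrite scaler_sumr -big_split /=; apply: eq_bigr => j _.
    by rewrite !mxE scalerDl scalerA.
  by rewrite gE map_mxD map_mxZ linearP.
have [h hE _] := bcN G.
move=> /(congr1 h); rewrite linear0 linear_sum => c0; apply/piE.
rewrite -{}c0 {1}(matrix_sum_delta c) linear_sum; apply: eq_bigr => j _.
rewrite big_ord1 !linearZ /=; congr (_ *: _); rewrite hE GE.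
transitivity (g (\sum_i (delta_mx j 0 : 'cV[A]_p) i 0 *: y i)); last first.
  congr g; rewrite (bigD1 j) //= !mxE !eqxx scale1r big1 ?addr0 // => i /negPf ne.
  by rewrite mxE ne scale0r.
by rewrite gE map_delta_mx.
Qed.

End BaseChange.

Lemma exterior_power_ind (R : comNzRingType) (M L : lmodType R) e
    (w : {ffun 'I_e -> M} -> L) (N : L -> Prop) :
  is_exterior_power w -> submodule N -> (forall v, N (w v)) -> forall l, N l.
Proof.
move=> [_ extw] subN Nw l; have [C [p [_ pE]]] := quotient_module subN.
have [|z zE] := @linear_map R L C (fun _ => 0); first by move=> *; rewrite scaler0 addr0.
have [|h _ hU] := extw C (fun _ => 0).
  by split=> // i v c y x /=; rewrite scaler0 addr0.
apply/pE; rewrite -[RHS](zE l) (hU p) ?(hU z) // => v; exact/pE.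
Qed.

(* Stated with the ring operations, which avoids the copies of them on R^o. *)
Lemma is_ideal_intro (R : comNzRingType) (I : R -> Prop) :
  I 0 -> (forall c x y : R, I x -> I y -> I (c * x + y)) -> is_ideal I.
Proof. by []. Qed.

(** * Non-zero-divisors *)

Section NonZeroDivisors.
Variable R : comNzRingType.

Lemma nonzerodivisorM (s t : R) :
  nonzerodivisor s -> nonzerodivisor t -> nonzerodivisor (s * t).
Proof. by move=> nzs nzt y; rewrite -mulrA => /nzs/nzt. Qed.

Lemma nonzerodivisor1 : nonzerodivisor (1 : R).
Proof. by move=> y; rewrite mul1r. Qed.

Lemma nonzerodivisorX (s : R) n : nonzerodivisor s -> nonzerodivisor (s ^+ n).
Proof.
move=> nzs; elim: n => [|n IHn]; first exact: nonzerodivisor1.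
by rewrite exprS; apply: nonzerodivisorM.
Qed.

Lemma nonzerodivisor_prod (I : Type) (r : seq I) (P : pred I) (F : I -> R) :
  (forall i, P i -> nonzerodivisor (F i)) ->
  nonzerodivisor (\prod_(i <- r | P i) F i).
Proof.
move=> nzF; apply: big_ind => //; first exact: nonzerodivisor1.
exact: nonzerodivisorM.
Qed.

Lemma nonzerodivisor_divl (s t : R) : nonzerodivisor (s * t) -> nonzerodivisor s.
Proof. by move=> nz y sy; apply: nz; rewrite mulrAC sy mul0r. Qed.

Lemma nonzerodivisor_inj (s : R) : nonzerodivisor s -> injective ( *%R s).
Proof.
by move=> nzs x y sxy; apply/eqP; rewrite -subr_eq0; apply/eqP/nzs; rewrite mulrBr sxy subrr.
Qed.

Lemma nonzerodivisor_neq0 : ~ nonzerodivisor (0 : R).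
Proof. by move=> /(_ 1); rewrite mul0r => /(_ erefl) /eqP; rewrite oner_eq0. Qed.

End NonZeroDivisors.

(** * Determinants and ideals of minors *)

Section Minors.
Variable R : comNzRingType.

Lemma det_rowsub_perm n (s : 'S_n) (A : 'M[R]_n) :
  \det (rowsub s A) = (-1) ^+ s * \det A.
Proof.
suff -> : rowsub s A = row_perm s A by rewrite row_permE det_mulmx det_perm.
by apply/matrixP => i j; rewrite !mxE.
Qed.

Lemma det_colsub_perm n (s : 'S_n) (A : 'M[R]_n) :
  \det (colsub s A) = (-1) ^+ s * \det A.
Proof.
rewrite -det_tr -[in RHS]det_tr -det_rowsub_perm; congr (\det _).
by apply/matrixP => i j; rewrite !mxE.
Qed.

Lemma det_colsub_eq0 n p (f : 'I_n -> 'I_p) (A : 'M[R]_(n, p)) :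
  ~~ injectiveb f -> \det (colsub f A) = 0.
Proof.
move=> /injectivePn [i [j ne_ij eq_f]]; rewrite -det_tr.
by apply: (determinant_alternate ne_ij) => l; rewrite !mxE eq_f.
Qed.

Lemma det_rowsub_eq0 n p (f : 'I_n -> 'I_p) (A : 'M[R]_(p, n)) :
  ~~ injectiveb f -> \det (rowsub f A) = 0.
Proof.
move=> ninj; rewrite -det_tr -(det_colsub_eq0 A^T ninj).
by congr (\det _); apply/matrixP => i j; rewrite !mxE.
Qed.

Lemma det_mxsub_rows n p (f : 'I_n -> 'I_p) (g : 'I_n -> 'I_n) (A : 'M[R]_(p, n)) :
  \det (mxsub f g A) = \det (rowsub f A) * \det (colsub g (1%:M : 'M[R]_n)).
Proof.
by rewrite -det_mulmx mulmx_colsub mulmx1; congr (\det _); apply/matrixP => i j; rewrite !mxE.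
Qed.

Lemma det_mxsub_cols n p (f : 'I_n -> 'I_n) (g : 'I_n -> 'I_p) (A : 'M[R]_(n, p)) :
  \det (mxsub f g A) = \det (rowsub f (1%:M : 'M[R]_n)) * \det (colsub g A).
Proof.
by rewrite -det_mulmx mul_rowsub_mx mul1mx; congr (\det _); apply/matrixP => i j; rewrite !mxE.
Qed.

(** Cauchy-Binet before terms are collected: the columns of P V are combinations of columns of P,
    and multilinearity gives a sum over all functions h, where the non-injective ones contribute
    0. *)
Lemma det_mulmx_expand n p (P : 'M[R]_(n, p)) (V : 'M[R]_(p, n)) :
  \det (P *m V) =
  \sum_(h : {ffun 'I_n -> 'I_p}) (\prod_i V (h i) i) * \det (colsub h P).
Proof.
rewrite -det_tr [LHS]/determinant.
transitivity (\sum_(s : 'S_n) \sum_(h : {ffun 'I_n -> 'I_p})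
    (-1) ^+ s * \prod_i (P (s i) (h i) * V (h i) i)).
  apply: eq_bigr => s _; rewrite -big_distrr /=.
  rewrite -(bigA_distr_bigA (fun i j => P (s i) j * V j i)); congr (_ * _).
  by apply: eq_bigr => i _; rewrite !mxE.
rewrite exchange_big /=; apply: eq_bigr => h _; rewrite -det_tr /determinant big_distrr /=.
apply: eq_bigr => s _; rewrite mulrCA; congr (_ * _).
by rewrite -big_split /=; apply: eq_bigr => i _; rewrite !mxE mulrC.
Qed.

Lemma minors_ideal_submodule p q t (A : 'M[R]_(p, q)) : is_ideal (minors_ideal t A).
Proof. exact: lspan_submodule. Qed.

Lemma minors_ideal_mem p q t (A : 'M[R]_(p, q)) (f : 'I_t -> 'I_p) (g : 'I_t -> 'I_q) :
  minors_ideal t A (\det (mxsub f g A)).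
Proof. by apply: (@lspan_mem R R^o); exists f, g. Qed.

Lemma minors_ideal_min p q t (A : 'M[R]_(p, q)) (I : R -> Prop) : is_ideal I ->
  (forall (f : 'I_t -> 'I_p) (g : 'I_t -> 'I_q), I (\det (mxsub f g A))) ->
  forall y, minors_ideal t A y -> I y.
Proof.
by move=> idI IA; apply: (@lspan_min R R^o) => // _ [f [g ->]]; apply: IA.
Qed.

Lemma minors_ideal_min_rows p n (A : 'M[R]_(p, n)) (I : R -> Prop) : is_ideal I ->
  (forall f : 'I_n -> 'I_p, I (\det (rowsub f A))) -> forall y, minors_ideal n A y -> I y.
Proof.
move=> idI IA; apply: minors_ideal_min => // f g.
by rewrite det_mxsub_rows mulrC; apply: (@submoduleZ R R^o).
Qed.

Lemma minors_ideal_min_cols p n (A : 'M[R]_(n, p)) (I : R -> Prop) : is_ideal I ->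
  (forall g : 'I_n -> 'I_p, I (\det (colsub g A))) -> forall y, minors_ideal n A y -> I y.
Proof.
move=> idI IA; apply: minors_ideal_min => // f g.
by rewrite det_mxsub_cols; apply: (@submoduleZ R R^o).
Qed.

Lemma minors_ideal_mulmx n p (P : 'M[R]_(n, p)) (V : 'M[R]_(p, n)) :
  minors_ideal n P (\det (P *m V)).
Proof.
rewrite det_mulmx_expand; apply: (@submodule_sum R R^o) => [|h _].
  exact: minors_ideal_submodule.
by apply: (@submoduleZ R R^o); [exact: minors_ideal_submodule | exact: minors_ideal_mem].
Qed.

Lemma det_mulmx_eq0 n p (P : 'M[R]_(n, p)) (V : 'M[R]_(p, n)) :
  (p < n)%N -> \det (P *m V) = 0.
Proof.
move=> lt_pn; rewrite det_mulmx_expand big1 // => h _.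
rewrite det_colsub_eq0 ?mulr0 //; apply/injectiveP => h_inj.
by have := leq_card h h_inj; rewrite !card_ord leqNgt lt_pn.
Qed.

Lemma injective_complement e k (T : finType) (h : 'I_e -> T) :
  #|T| = (e + k)%N -> injective h ->
  exists2 h' : 'I_k -> T, injective h' & forall i l, h i != h' l.
Proof.
move=> cardT h_inj; pose C := ~: [set h i | i : 'I_e].
have cardC : #|C| = k by rewrite cardsCs setCK card_imset // card_ord cardT addKn.
exists (fun l => enum_val (cast_ord (esym cardC) l)) => [l l'|i l].
  by move=> /enum_val_inj/cast_ord_inj.
have := enum_valP (cast_ord (esym cardC) l); rewrite inE.
by apply: contraNneq => <-; apply/imsetP; exists i.
Qed.

Lemma perm_of_complements e k (h : 'I_e -> 'I_(e + k)) (h' : 'I_k -> 'I_(e + k)) :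
    injective h -> injective h' -> (forall i l, h i != h' l) ->
  exists s : 'S_(e + k),
    (forall i, s (lshift k i) = h i) /\ (forall l, s (rshift e l) = h' l).
Proof.
move=> h_inj h'_inj hh'.
pose F j := match split j with inl i => h i | inr l => h' l end.
have F_inj : injective F.
  move=> j1 j2; rewrite /F -{2}(splitK j1) -{2}(splitK j2).
  case: (split j1) (split j2) => [i1|l1] [i2|l2] /=.
  - by move=> /h_inj->.
  - by move/eqP; rewrite (negPf (hh' _ _)).
  - by move/esym/eqP; rewrite (negPf (hh' _ _)).
  - by move=> /h'_inj->.
exists (perm F_inj); split=> j; rewrite permE /F.
  by rewrite (unsplitK (inl j)).
by rewrite (unsplitK (inr j)).
Qed.

(** * Complementary minors *)

Section Complement.
Variables (e k : nat) (P : 'M[R]_(e, e + k)) (S : 'M[R]_(e + k, e)).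
Variables (rho : 'M[R]_(e + k, k)) (s : R).
Hypotheses (PS : P *m S = s%:M) (Prho : P *m rho = 0).
Let beta := \det (row_mx S rho).

Lemma det_complement (f : 'I_k -> 'I_(e + k)) :
  s ^+ e * \det (rowsub f rho) = beta * \det (col_mx P (rowsub f 1%:M)).
Proof.
rewrite mulrC -[RHS]mulrC -det_mulmx mul_col_row PS Prho det_lblock det_scalar.
by rewrite mulrC mul_rowsub_mx mul1mx.
Qed.

(** The lower rows are supported on the columns in the image of [h']. Moving the columns chosen by
    [h] to the front, by [t], makes the matrix block triangular. *)
Lemma det_col_mx_rowsub (t : 'S_(e + k)) (h : 'I_e -> 'I_(e + k)) (h' : 'I_k -> 'I_(e + k)) :
  (forall i, t (lshift k i) = h i) -> (forall l, t (rshift e l) = h' l) ->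
  \det (colsub h P) = (-1) ^+ t * \det (col_mx P (rowsub h' 1%:M)).
Proof.
move=> th th'; rewrite -det_colsub_perm.
suff -> : colsub t (col_mx P (rowsub h' 1%:M)) =
    block_mx (colsub h P) (colsub h' P) 0 1%:M by rewrite det_ublock det1 mulr1.
apply/matrixP => i j; rewrite !mxE.
case: (split i) => a; rewrite !mxE; case: splitP => b bE; rewrite !mxE.
- by congr (P _ _); rewrite -th; congr (t _); apply: val_inj.
- by congr (P _ _); rewrite -th'; congr (t _); apply: val_inj.
- have -> : j = lshift k b by apply: val_inj.
  by rewrite -th' (inj_eq perm_inj) eq_rlshift.
- have -> : j = rshift e b by apply: val_inj.
  by rewrite -th' (inj_eq perm_inj) eq_rshift.
Qed.

Lemma minors_complement_rho y : minors_ideal k rho y ->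
  exists2 d, minors_ideal e P d & s ^+ e * y = beta * d.
Proof.
move: y; apply: minors_ideal_min_rows.
  split=> [|c y z [d1 Pd1 d1E] [d2 Pd2 d2E]].
    by exists 0; rewrite ?mulr0 //; case: (@minors_ideal_submodule _ _ e P).
  exists (c * d1 + d2); first by case: (@minors_ideal_submodule _ _ e P) => _; apply.
  by rewrite !mulrDr d2E ![_ * (c * _)]mulrCA d1E.
move=> f; rewrite det_complement; exists (\det (col_mx P (rowsub f 1%:M))) => //.
have [/injectiveP f_inj|ninj] := boolP (injectiveb f); last first.
  rewrite (_ : \det _ = 0); first by case: (@minors_ideal_submodule _ _ e P).
  have /injectivePn [i [j ne_ij eq_f]] := ninj.
  have ne : rshift e i != rshift e j by rewrite eq_rshift.
  by apply: (determinant_alternate ne) => l; rewrite !col_mxEd !mxE eq_f.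
have [|h h_inj hh'] := @injective_complement k e 'I_(e + k) f _ f_inj.
  by rewrite card_ord addnC.
have [|t [th tf]] := perm_of_complements h_inj f_inj.
  by move=> i l; rewrite eq_sym.
have := det_col_mx_rowsub th tf => /(congr1 ( *%R ((-1) ^+ t))).
rewrite mulrA -expr2 sqrr_sign mul1r => <-.
apply: (@submoduleZ R R^o); first exact: minors_ideal_submodule.
exact: (minors_ideal_mem _ id h).
Qed.

Lemma minors_complement_P d : minors_ideal e P d ->
  exists2 y, minors_ideal k rho y & s ^+ e * y = beta * d.
Proof.
move: d; apply: minors_ideal_min_cols.
  split=> [|c y z [d1 Pd1 d1E] [d2 Pd2 d2E]].
    by exists 0; rewrite ?mulr0 //; case: (@minors_ideal_submodule _ _ k rho).
  exists (c * d1 + d2); first by case: (@minors_ideal_submodule _ _ k rho) => _; apply.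
  by rewrite !mulrDr d2E ![_ * (c * _)]mulrCA d1E.
move=> h; have [/injectiveP h_inj|ninj] := boolP (injectiveb h); last first.
  exists 0; first by case: (@minors_ideal_submodule _ _ k rho).
  by rewrite det_colsub_eq0 // !mulr0.
have [|f f_inj hf] := @injective_complement e k 'I_(e + k) h _ h_inj.
  by rewrite card_ord.
have [t [th tf]] := perm_of_complements h_inj f_inj hf.
exists ((-1) ^+ t * \det (rowsub f rho)); last first.
  by rewrite mulrCA det_complement (det_col_mx_rowsub th tf) mulrCA.
apply: (@submoduleZ R R^o); first exact: minors_ideal_submodule.
exact: (minors_ideal_mem _ f id).
Qed.

End Complement.

(* [P; 1_f] [S | A] is block triangular with determinant s^e det A_f, and it factors
   through R^n. *)
Lemma det_relations_eq0 e n t (P : 'M[R]_(e, n)) (S : 'M[R]_(n, e)) s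
    (A : 'M[R]_(n, t)) (f : 'I_t -> 'I_n) :
  nonzerodivisor s -> P *m S = s%:M -> P *m A = 0 -> (n < e + t)%N ->
  \det (rowsub f A) = 0.
Proof.
move=> nzs PS PA lt_n; apply: (nonzerodivisorX (n := e) nzs).
have := det_mulmx_eq0 (col_mx P (rowsub f 1%:M)) (row_mx S A) lt_n.
by rewrite mul_col_row PS PA det_lblock det_scalar mul_rowsub_mx mul1mx.
Qed.

(** * McCoy's theorem *)

Section McCoy.
Variables (p q : nat) (A : 'M[R]_(p, q)).
Hypothesis A_inj : forall v : 'cV_q, A *m v = 0 -> v = 0.

(* Adjoin to the t columns of the minor another column: its y-multiplied signed
   minors are the coefficients of a linear relation between the columns of A. *)
Lemma mccoy_step (y : R) t : (t < q)%N ->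
  (forall (f : 'I_t.+1 -> 'I_p) (g : 'I_t.+1 -> 'I_q), y * \det (mxsub f g A) = 0) ->
  forall (f : 'I_t -> 'I_p) (g : 'I_t -> 'I_q), y * \det (mxsub f g A) = 0.
Proof.
move=> lt_tq minor0 f g.
have [c0 c0g] : exists c0, forall l, c0 != g l.
  have : ~~ [forall c, c \in codom g].
    apply/negP => /forallP g_onto; have := leq_image_card g predT.
    rewrite card_ord leqNgt => /negP; apply; apply: leq_trans lt_tq _.
    by rewrite -[X in (X <= _)%N]card_ord; apply/subset_leq_card/subsetP => c _; apply: g_onto.
  rewrite negb_forall => /existsP [c0 c0g]; exists c0 => l.
  by apply: contraNneq c0g => ->; apply: codom_f.
pose ext T (z : T) (h : 'I_t -> T) (a : 'I_t.+1) := oapp h z (unlift ord0 a).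
have ext0 T z h : @ext T z h ord0 = z by rewrite /ext unlift_none.
have extS T z h l : @ext T z h (lift ord0 l) = h l by rewrite /ext liftK.
pose N := mxsub f (ext _ c0 g) A.
pose cof a : R := (-1) ^+ (a : 'I_t.+1) * \det (col' a N).
pose v : 'cV[R]_q := \sum_a (y * cof a) *: delta_mx (ext _ c0 g a) 0.
have v0 : v = 0.
  apply: A_inj; apply/matrixP => i j; rewrite [RHS]mxE -(minor0 (ext _ i f) (ext _ c0 g)).
  rewrite (expand_det_row _ ord0) mulmx_sumr summxE big_distrr /=.
  apply: eq_bigr => a _; rewrite -scalemxAr mxE mxE.
  rewrite (bigD1 (ext _ c0 g a)) //= big1 ?addr0; last first.
    by move=> l /negPf ne; rewrite mxE ne mulr0.
  rewrite !mxE (ord1 j) !eqxx mulr1 -mulrA ext0 [cof a * _]mulrC; congr (_ * (_ * _)).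
  rewrite /cofactor add0n; congr (_ * \det _).
  by apply/matrixP => l l'; rewrite !mxE extS.
(* Since c0 is not a value of g, the entry of v at c0 comes from the adjoined column alone, and it
   is y times the given minor. *)
have /matrixP/(_ c0 0) := v0; rewrite summxE big_ord_recl big1 ?addr0.
  rewrite !mxE ext0 !eqxx mulr1 /cof expr0 mul1r => <-; congr (_ * \det _).
  by apply/matrixP => l l'; rewrite !mxE extS.
by move=> l _; rewrite !mxE extS (negPf (c0g _)) mulr0.
Qed.

(** The step lowers t until only the empty minor is left; its value is 1, so y = 0. *)
Lemma mccoy (y : R) t : (t <= q)%N ->
  (forall (f : 'I_t -> 'I_p) (g : 'I_t -> 'I_q), y * \det (mxsub f g A) = 0) -> y = 0.
Proof.
elim: t => [|t IHt] le_tq minor0.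
  have f0 T : 'I_0 -> T by case.
  by have := minor0 (f0 _) (f0 _); rewrite det_mx00 mulr1.
by apply: IHt; [apply: ltnW | apply: mccoy_step].
Qed.

End McCoy.

(** McCoy's theorem with t = n: every selection of n rows and n columns has for determinant a
    multiple of det A. *)
Lemma nonzerodivisor_det n (A : 'M[R]_n) :
  (forall v : 'cV_n, A *m v = 0 -> v = 0) -> nonzerodivisor (\det A).
Proof.
move=> A_inj y detA; apply: (mccoy A_inj (leqnn n)) => f g.
rewrite det_mxsub_rows rowsubE det_mulmx mulrCA mulrA.
by rewrite -[_ * y]mulrA detA mulr0 mul0r.
Qed.

(** * The map of the Hilbert-Burch complex *)

Section HilbertBurch.
Variables (k : nat) (psi : 'M[R]_(k.+1, k)).

(** By expansion along the first column, the linear form on R^(k+1) whose coefficients are the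
    signed maximal minors of [psi]. *)
Definition signed_minors (c : 'cV[R]_k.+1) : R := \det (row_mx c psi : 'M_(1 + k)).

Lemma signed_minors_linear a c1 c2 :
  signed_minors (a *: c1 + c2) = a * signed_minors c1 + signed_minors c2.
Proof.
rewrite /signed_minors -[LHS]det_tr -(det_tr (row_mx c1 _)) -(det_tr (row_mx c2 _)).
rewrite -[\det (row_mx c2 _)^T]mul1r; apply: (determinant_multilinear (i0 := ord0)).
- by apply/matrixP => i j; rewrite !mxE; case: splitP => // l _; rewrite !mxE mul1r.
- by apply/matrixP => i j; rewrite !mxE; case: splitP => // -[[]].
- by apply/matrixP => i j; rewrite !mxE; case: splitP => // -[[]].
Qed.

Lemma signed_minors0 : signed_minors 0 = 0.
Proof. by have := signed_minors_linear (-1) 0 0; rewrite scaler0 addr0 mulN1r addNr. Qed.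

Lemma signed_minors_minors c : minors_ideal k psi (signed_minors c).
Proof.
rewrite /signed_minors (expand_det_col _ ord0).
apply: (@submodule_sum R R^o) => [|i _]; first exact: minors_ideal_submodule.
apply: (@submoduleZ R R^o); first exact: minors_ideal_submodule.
apply: (@submoduleZ R R^o); first exact: minors_ideal_submodule.
rewrite (_ : row' i _ = mxsub (lift i) id psi); first exact: minors_ideal_mem.
apply/matrixP => a b; rewrite !mxE; case: splitP => [[[]]//|l /= lE].
by congr (psi _ _); apply: val_inj; move: lE => [].
Qed.

Lemma minors_signed_minors y : minors_ideal k psi y -> exists c, signed_minors c = y.
Proof.
move: y; apply: minors_ideal_min_rows.
  split=> [|c _ _ [c1 <-] [c2 <-]]; first by exists 0; rewrite signed_minors0.
  by exists (c *: c1 + c2); rewrite signed_minors_linear.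
move=> f; have [/injectiveP f_inj|ninj] := boolP (injectiveb f); last first.
  by exists 0; rewrite det_rowsub_eq0 // signed_minors0.
have [|h h_inj hf] := @injective_complement k 1 'I_(1 + k) f _ f_inj.
  by rewrite card_ord addn1.
have [|t [th tf]] := perm_of_complements h_inj f_inj.
  by move=> i l; rewrite eq_sym.
(* [h 0] is the one row that f omits: the basis vector there isolates the minor on the other rows,
   and the sign of [t] corrects their order. *)
exists ((-1) ^+ t *: delta_mx (h 0) 0).
have := signed_minors_linear ((-1) ^+ t) (delta_mx (h 0) 0) 0.
rewrite signed_minors0 !addr0 => ->; rewrite /signed_minors -det_rowsub_perm.
suff -> : rowsub t (row_mx (delta_mx (h 0) 0) psi) =
    block_mx (1%:M : 'M_1) (rowsub h psi) 0 (rowsub f psi).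
  by rewrite det_ublock det1 mul1r.
apply/matrixP => i j; case: (split_ordP i) (split_ordP j) => a -> [] b ->;
  rewrite ?(block_mxEul, block_mxEur, block_mxEdl, block_mxEdr) !mxE ?th ?tf;
  rewrite ?(unsplitK (inl _)) ?(unsplitK (inr _)) ?mxE //.
- by rewrite (ord1 a) (ord1 b) !eqxx.
- by rewrite (negPf (hf _ _)).
Qed.

(** When det [c | psi] = 0, each column of the adjugate is a linear relation between c and the
    columns of [psi]. With the row omitted by f moved to the front, the first column gives c the
    coefficient det psi_f. *)
Lemma signed_minors_ker c y : signed_minors c = 0 -> minors_ideal k psi y ->
  exists v, y *: c = psi *m v.
Proof.
move=> c0; move: y; apply: minors_ideal_min_rows.
  split=> [|a y z [v1 E1] [v2 E2]]; first by exists 0; rewrite scale0r mulmx0.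
  by exists (a *: v1 + v2); rewrite scalerDl -scalerA E1 E2 mulmxDr -scalemxAr.
move=> f; have [/injectiveP f_inj|ninj] := boolP (injectiveb f); last first.
  by exists 0; rewrite det_rowsub_eq0 // scale0r mulmx0.
have [|h h_inj hf] := @injective_complement k 1 'I_(1 + k) f _ f_inj.
  by rewrite card_ord addn1.
have [|t [th tf]] := perm_of_complements h_inj f_inj.
  by move=> i l; rewrite eq_sym.
pose M : 'M[R]_(1 + k) := rowsub t (row_mx c psi).
have /matrixP/(_ _ (lshift k 0)) MadjM : M *m \adj M = 0.
  by rewrite mul_mx_adj det_rowsub_perm [\det _]c0 mulr0 raddf0.
have cof0 : \adj M (lshift k 0) (lshift k 0) = \det (rowsub f psi).
  rewrite mxE /cofactor expr0 mul1r; congr (\det _); apply/matrixP => a b.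
  have liftE (l : 'I_k) : @lift (1 + k) (lshift k 0) l = rshift 1 l by apply: val_inj.
  by rewrite !mxE !liftE (unsplitK (inr b)) tf.
exists (- \col_l \adj M (rshift 1 l) (lshift k 0)); rewrite mulmxN; apply/eqP.
rewrite -addr_eq0; apply/eqP/matrixP => i j; rewrite (ord1 j).
have [u ->] : exists u, i = t u by exists ((t^-1)%g i); rewrite permKV.
have := MadjM u; rewrite !mxE big_split_ord big_ord1 /= cof0 => E.
rewrite -[RHS]E; congr (_ + _).
  by rewrite mxE mulrC !mxE (unsplitK (inl 0)).
by apply: eq_bigr => l _; rewrite !mxE (unsplitK (inr l)).
Qed.

End HilbertBurch.

End Minors.

(** T is the graph of a division such as y = beta d / s^e. Linearity together with y = 0 <-> z = 0
    makes it single-valued and injective, and a choice function extended by 0 outside A is the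
    isomorphism. *)
Lemma submod_iso_rel (R : comNzRingType) (M N : lmodType R)
    (A : M -> Prop) (B : N -> Prop) (T : M -> N -> Prop) :
    submodule A ->
    (forall y, A y -> exists2 z, B z & T y z) ->
    (forall z, B z -> exists2 y, A y & T y z) ->
    (forall c y1 z1 y2 z2, T y1 z1 -> T y2 z2 -> T (c *: y1 + y2) (c *: z1 + z2)) ->
    (forall y z, T y z -> y = 0 <-> z = 0) ->
  submod_iso A B.
Proof.
move=> [_ Alin] Ttot Tonto Tlin T0.
have Tfun y z y' z' : T y z -> T y' z' -> y = y' <-> z = z'.
  move=> Tyz Tyz'; have := T0 _ _ (Tlin (-1) _ _ _ _ Tyz Tyz').
  by rewrite !scaleN1r ![- _ + _]addrC => yz; split=> eq1; apply/esym/eqP;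
    rewrite -subr_eq0; apply/eqP/yz; rewrite eq1 subrr.
have /choice [f fP] y : exists z, A y -> B z /\ T y z.
  by have [/Ttot [z Bz Tyz]|nAy] := EM (A y); [exists z | exists 0].
exists f; split=> [y /fP[]//|c y z Ay Az|y z Ay Az eq_f|z Bz].
- have [_ Ty] := fP _ Ay; have [_ Tz] := fP _ Az; have Tcyz := Tlin c _ _ _ _ Ty Tz.
  by have [_ Tf] := fP _ (Alin c _ _ Ay Az); apply/(Tfun _ _ _ _ Tf Tcyz).
- have [_ Ty] := fP _ Ay; have [_ Tz] := fP _ Az.
  by apply/(Tfun _ _ _ _ Ty Tz).
- have [y Ay Tyz] := Tonto z Bz; exists y => //.
  by have [_ Tf] := fP _ Ay; apply/(Tfun _ _ _ _ Tf Tyz).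
Qed.

(** * Denominators, and isomorphisms up to a non-zero-divisor *)

Section Fractions.
Variables (R Q : comNzRingType) (iota : {rmorphism R -> Q}).
Hypothesis fracQ : is_localization (@nonzerodivisor R) iota.

Lemma fractions_inj : injective iota.
Proof.
move=> a b eq_ab; have [_ _ ker0] := fracQ; apply/eqP; rewrite -subr_eq0; apply/eqP.
have [|s nzs /nzs //] := ker0 (a - b).
by rewrite rmorphB; apply/eqP; rewrite subr_eq0; apply/eqP.
Qed.

Lemma fractions_unit s : nonzerodivisor s -> exists t, iota s * t = 1.
Proof. by case: fracQ => unitQ _ _; apply: unitQ. Qed.

Lemma fractions_scale_inj (M : lmodType Q) s :
  nonzerodivisor s -> injective (fun u : M => iota s *: u).
Proof.
move=> /fractions_unit [t st] u v /(congr1 (fun w => t *: w)).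
by rewrite !scalerA mulrC st !scale1r.
Qed.

(** W is stable under scalars from R only. Writing t c = a with a and t from R, a denominator of c u
    + v is t s1 s2. *)
Lemma fractions_submodule (M : lmodType Q) (W : M -> Prop) :
    W 0 -> (forall c u v, W u -> W v -> W (iota c *: u + v)) ->
  submodule (fun u => exists2 s, nonzerodivisor s & W (iota s *: u)).
Proof.
move=> W0 Wlin; split.
  by exists 1; [exact: nonzerodivisor1 | rewrite scaler0].
move=> c u v [s1 nz1 W1] [s2 nz2 W2]; have [_ frac _] := fracQ.
have [a [t [nzt tcE]]] := frac c.
exists (t * s1 * s2); first by do 2?apply: nonzerodivisorM.
have -> : iota (t * s1 * s2) *: (c *: u + v) =
    iota (s2 * a) *: (iota s1 *: u) + (iota (t * s1) *: (iota s2 *: v) + 0).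
  rewrite addr0 scalerDr !scalerA; congr (_ *: _ + _ *: _); last by rewrite -rmorphM.
  rewrite !rmorphM -tcE mulrAC [iota s2 * _]mulrC.
  by rewrite [_ * iota s1 * c]mulrAC mulrAC.
by apply: (Wlin) => //; apply: Wlin.
Qed.

Lemma common_denominator (M : lmodType Q) (W : M -> Prop) (I : finType) (u : I -> M) :
    W 0 -> (forall c u v, W u -> W v -> W (iota c *: u + v)) ->
    (forall i, exists2 s, nonzerodivisor s & W (iota s *: u i)) ->
  exists2 s, nonzerodivisor s & forall i, W (iota s *: u i).
Proof.
move=> W0 Wlin denoms.
have /choice [s sP] i : exists s, nonzerodivisor s /\ W (iota s *: u i).
  by have [s] := denoms i; exists s.
exists (\prod_i s i); first by apply: nonzerodivisor_prod => i _; case: (sP i).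
move=> i; rewrite (bigD1 i) //= mulrC rmorphM -scalerA -[_ *: _]addr0.
by apply: Wlin => //; case: (sP i).
Qed.

(** If [b u] = 0, the coordinates of u form a Q-combination of relations over R. A common
    denominator s turns it into a relation over R, because R embeds in Q, and this relation says s u
    = 0. *)
Lemma base_change_torsion (M : lmodType R) (MQ : lmodType Q)
    (b : {linear M -> MQ | iota \; *:%R}) u :
  finitely_generated M -> is_base_change b -> b u = 0 -> torsion u.
Proof.
move=> [p [y y_gen]] bcb; have /fam_spanP [c ->] := y_gen u => buE.
pose rels (z : 'cV[Q]_p) :=
  exists2 r : 'cV[R]_p, \sum_j r j 0 *: y j = 0 & z = map_mx iota r.
have rels0 : rels 0.
  by exists 0; rewrite ?map_mx0 // big1 // => j _; rewrite mxE scale0r.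
have relsD d z1 z2 : rels z1 -> rels z2 -> rels (iota d *: z1 + z2).
  move=> [r1 r1E ->] [r2 r2E ->]; exists (d *: r1 + r2); last by rewrite map_mxD map_mxZ.
  transitivity (d *: (\sum_j r1 j 0 *: y j) + \sum_j r2 j 0 *: y j).
    rewrite scaler_sumr -big_split; apply: eq_bigr => j _.
    by rewrite /= !mxE scalerDl scalerA.
  by rewrite r1E r2E scaler0 addr0.
have rel_c : \sum_j (map_mx iota (\col_j c j) : 'cV_p) j 0 *: b (y j) = 0.
  by rewrite -[RHS]buE linear_sum; apply: eq_bigr => j _; rewrite !mxE linearZ_LR.
have subrels := fractions_submodule rels0 relsD.
have [|s nzs [r rE sE]] := lspan_min subrels _ (base_change_rel bcb y_gen rel_c).
  by move=> z zrel; exists 1; [exact: nonzerodivisor1 | rewrite rmorph1 scale1r].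
exists s => //; rewrite -[RHS]rE scaler_sumr; apply: eq_bigr => j _.
rewrite scalerA; congr (_ *: _); apply: fractions_inj.
by have /matrixP/(_ j 0) := sE; rewrite !mxE rmorphM.
Qed.

End Fractions.

(* The map f is an isomorphism up to the non-zero-divisor s, u being its inverse
   up to s on the standard basis; such data express that E has rank e and, unlike
   has_rank, are preserved by flat base change in an obvious way. *)
Definition rank_splitting (R : comNzRingType) (E : lmodType R) e
    (f : {linear E -> 'rV[R]_e}) (u : 'I_e -> E) (s : R) :=
  [/\ nonzerodivisor s, forall i, f (u i) = s *: delta_mx 0 i
    & forall v, \sum_i f v 0 i *: u i = s *: v].

(** [h] becomes integral on the finitely many generators after multiplication by some s1, which
    gives [F]; the preimages of the standard basis come from E after multiplication by some s2,
    which gives [u]. Then F u = s1 s2 exactly, but u F = s1 s2 only up to torsion. *)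
Lemma fractions_splitting (R Q : comNzRingType) (iota : {rmorphism R -> Q})
    (E : lmodType R) e (MQ : lmodType Q) (b : {linear E -> MQ | iota \; *:%R})
    (h : {linear MQ -> 'rV[Q]_e}) :
    is_localization (@nonzerodivisor R) iota -> finitely_generated E ->
    is_base_change b -> bijective h ->
  exists (f : {linear E -> 'rV[R]_e}) u s, rank_splitting f u s.
Proof.
move=> fracQ fgE bcb [h' hK h'K]; have [p [y y_gen]] := fgE.
have iota_inj := fractions_inj fracQ.
have mx_inj (w1 w2 : 'rV[R]_e) : map_mx iota w1 = map_mx iota w2 -> w1 = w2.
  move/matrixP => eq_w; apply/matrixP => i j; apply: iota_inj.
  by have := eq_w i j; rewrite !mxE.
pose int (z : 'rV[Q]_e) := exists w : 'rV[R]_e, z = map_mx iota w.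
have int0 : int 0 by exists 0; rewrite map_mx0.
have intD c z1 z2 : int z1 -> int z2 -> int (iota c *: z1 + z2).
  by move=> [w1 ->] [w2 ->]; exists (c *: w1 + w2); rewrite map_mxD map_mxZ.
pose frac z := exists2 s, nonzerodivisor s & int (iota s *: z).
have frac_sub : submodule frac by apply: fractions_submodule.
have fracT z : frac z.
  rewrite [z]row_sum_delta; apply: submodule_sum => // i _; apply: submoduleZ => //.
  exists 1; first exact: nonzerodivisor1.
  by rewrite rmorph1 scale1r; exists (delta_mx 0 i); rewrite map_delta_mx.
have [s1 nzs1 int1] : exists2 s, nonzerodivisor s & forall j, int (iota s *: h (b (y j))).
  exact: (common_denominator int0 intD (fun j => fracT _)).
have /choice [f fE] u : exists w, map_mx iota w = iota s1 *: h (b u).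
  suff [w wE] : int (iota s1 *: h (b u)) by exists w.
  have /fam_spanP [c ->] := y_gen u; rewrite linear_sum /= linear_sum scaler_sumr.
  apply: (big_ind int) => // [_ _ [w1 ->] [w2 ->]|j _].
    by exists (w1 + w2); rewrite map_mxD.
  rewrite linearZ_LR /= linearZ scalerA mulrC -scalerA -[_ *: _]addr0; exact: intD.
have [|F FE] := @linear_map R E 'rV[R]_e f.
  move=> c u v; apply: mx_inj.
  rewrite map_mxD map_mxZ !fE linearP /= linearP scalerDr !scalerA.
  by congr (_ *: _ + _); rewrite mulrC.
pose img z := exists u, z = b u.
have img0 : img 0 by exists 0; rewrite linear0.
have imgD c z1 z2 : img z1 -> img z2 -> img (iota c *: z1 + z2).
  by move=> [u1 ->] [u2 ->]; exists (c *: u1 + u2); rewrite linearP.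
have imgT : forall z, exists2 s, nonzerodivisor s & img (iota s *: z).
  apply: (base_change_ind bcb); first exact: fractions_submodule.
  by move=> u; exists 1; [exact: nonzerodivisor1|rewrite rmorph1 scale1r; exists u].
have [s2 nzs2 img2] : exists2 s, nonzerodivisor s &
    forall i, img (iota s *: h' (delta_mx 0 i)).
  exact: (common_denominator img0 imgD (fun i => imgT _)).
have [u uE] := choice img2.
have fuE i : F (u i) = (s1 * s2) *: delta_mx 0 i.
  apply: mx_inj; rewrite FE fE -uE linearZ /= h'K scalerA.
  by rewrite map_mxZ map_delta_mx rmorphM.
(* The defect of the second identity. [F] kills it, so its image in MQ is 0 and it is torsion. *)
pose w v := \sum_i F v 0 i *: u i - (s1 * s2) *: v.
have Fw v : F (w v) = 0.
  rewrite linearB linearZ linear_sum /=; apply/eqP; rewrite subr_eq0; apply/eqP.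
  rewrite [F v in RHS]row_sum_delta scaler_sumr; apply: eq_bigr => i _.
  by rewrite linearZ /= fuE !scalerA mulrC.
have /choice [t tP] j : exists t, nonzerodivisor t /\ t *: w (y j) = 0.
  suff [t] : torsion (w (y j)) by exists t.
  apply: (base_change_torsion fracQ fgE bcb); apply: (can_inj hK).
  apply: (fractions_scale_inj fracQ nzs1) => /=.
  by rewrite -fE -FE Fw map_mx0 linear0 scaler0.
pose T := \prod_j t j.
have Tw v : T *: w v = 0.
  have /fam_spanP [c ->] := y_gen v.
  have -> : w (\sum_j c j *: y j) = \sum_j c j *: w (y j).
    transitivity (\sum_j (\sum_i (c j * F (y j) 0 i) *: u i - ((s1 * s2) * c j) *: y j)).
      rewrite sumrB exchange_big /=; congr (_ - _).
        apply: eq_bigr => i _; rewrite linear_sum summxE scaler_suml.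
        by apply: eq_bigr => j _; rewrite linearZ mxE.
      by rewrite scaler_sumr; apply: eq_bigr => j _; rewrite scalerA.
    apply: eq_bigr => j _; rewrite scalerBr scaler_sumr scalerA [c j * _]mulrC.
    by congr (_ - _); apply: eq_bigr => i _; rewrite scalerA.
  rewrite scaler_sumr big1 // => j _; rewrite scalerA mulrC -scalerA /T (bigD1 j) //=.
  by rewrite mulrC -scalerA; case: (tP j) => _ ->; rewrite !scaler0.
(* T annihilates the defect on every generator; rescaling [u] by T makes both identities exact. *)
exists F, (fun i => T *: u i), (T * (s1 * s2)); split=> [|i|v].
- do ?apply: nonzerodivisorM => //.
  by apply: nonzerodivisor_prod => j _; case: (tP j).
- by rewrite linearZ /= fuE scalerA.
- rewrite -scalerA; apply/eqP; rewrite -subr_eq0 -[X in _ == X](Tw v) /w scalerBr scaler_sumr.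
  by apply/eqP; congr (_ - _); apply: eq_bigr => i _; rewrite !scalerA mulrC.
Qed.

Lemma has_rank_splitting (R : comNzRingType) (E : lmodType R) e :
    finitely_generated E -> has_rank E e ->
  exists (f : {linear E -> 'rV[R]_e}) u s, rank_splitting f u s.
Proof.
move=> fgE [Q [MQ [b [fracQ bcb [h h_bij]]]]].
exact: fractions_splitting fracQ fgE bcb h_bij.
Qed.

(** * Alternating maps and determinants *)

Section Alternating.
Variables (R : comNzRingType) (M L : lmodType R) (e : nat).
Implicit Types (w : {ffun 'I_e -> M} -> L) (v : {ffun 'I_e -> M}).

Definition ffun_upd v (i : 'I_e) (y : M) : {ffun 'I_e -> M} :=
  [ffun j => if j == i then y else v j].

Lemma ffun_upd_id v i : ffun_upd v i (v i) = v.
Proof. by apply/ffunP => j; rewrite ffunE; case: eqP => [->|]. Qed.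

Lemma multilinearE w v i c y z : multilinear w ->
  w (ffun_upd v i (c *: y + z)) = c *: w (ffun_upd v i y) + w (ffun_upd v i z).
Proof. by move=> w_lin; apply: w_lin. Qed.

Lemma multilinear0 w v i : multilinear w -> w (ffun_upd v i 0) = 0.
Proof.
move=> w_lin; have := multilinearE v i (-1) 0 0 w_lin.
by rewrite scaler0 addr0 scaleN1r addNr.
Qed.

Lemma multilinearD w v i y z : multilinear w ->
  w (ffun_upd v i (y + z)) = w (ffun_upd v i y) + w (ffun_upd v i z).
Proof. by move=> w_lin; rewrite -[y]scale1r multilinearE // !scale1r. Qed.

Lemma multilinear_ind w n (x : 'I_n -> M) (N : L -> Prop) v :
  multilinear w -> submodule N ->
  (forall h : 'I_e -> 'I_n, N (w [ffun j => x (h j)])) ->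
  (forall j, fam_span x (v j)) -> N (w v).
Proof.
move=> w_lin subN Nx vx.
(* Induction on k, where the arguments of index at least k are generators already: k = 0 is the
   hypothesis on generators, k = e the claim. *)
suff Nk k : forall v, (forall j, fam_span x (v j)) ->
    (forall j : 'I_e, (k <= j)%N -> exists i, v j = x i) -> N (w v).
  by apply: (Nk e) => // j; rewrite leqNgt ltn_ord.
move=> {v vx}; elim: k => [|k IHk] v vx v_gen.
  have /choice [h hE] j := v_gen j isT.
  by rewrite (_ : v = [ffun j => x (h j)]) //; apply/ffunP => j; rewrite ffunE.
have [lt_ke|le_ek] := ltnP k e; last first.
  apply: IHk => // j le_kj; apply: v_gen; rewrite ltn_neqAle le_kj andbT.
  by apply: contraTneq (ltn_ord j) => <-; rewrite -leqNgt.
pose i := Ordinal lt_ke; rewrite -(ffun_upd_id v i).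
have subNi : submodule (fun y => N (w (ffun_upd v i y))).
  split=> [|c y z Ny Nz]; first by rewrite multilinear0 //; case: subN.
  by rewrite multilinearE //; case: subN => _; apply.
apply: (lspan_min subNi _ (vx i)) => _ [a ->].
apply: IHk => j; rewrite ffunE; case: eqP => [_|/eqP ne_ji] //.
- by apply: lspan_mem; exists a.
- by exists a.
- move=> le_kj; apply: v_gen; rewrite ltn_neqAle le_kj andbT.
  by apply: contraNneq ne_ji => k_eq; apply/eqP/val_inj.
Qed.

Lemma alternating_tperm w v i j : alternating w -> i != j ->
  w [ffun l => v (tperm i j l)] = - w v.
Proof.
move=> [w_lin w_alt] ne_ij; apply/eqP; rewrite -addr_eq0 addrC; apply/eqP.
pose u y z := ffun_upd (ffun_upd v i y) j z.
have uD y1 y2 z : w (u (y1 + y2) z) = w (u y1 z) + w (u y2 z).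
  have swap y : u y z = ffun_upd (ffun_upd v j z) i y.
    apply/ffunP => l; rewrite !ffunE; case: eqP => // ->.
    by rewrite eq_sym (negPf ne_ij).
  by rewrite !swap multilinearD.
have u_alt y : w (u y y) = 0.
  by apply: (w_alt _ _ _ ne_ij); rewrite !ffunE !eqxx; case: ifP.
have := u_alt (v i + v j); rewrite uD !multilinearD // !u_alt add0r addr0.
suff [-> ->] : ffun_upd (ffun_upd v i (v i)) j (v j) = v /\
    ffun_upd (ffun_upd v i (v j)) j (v i) = [ffun l => v (tperm i j l)] by [].
split; apply/ffunP => l; rewrite !ffunE.
  by case: eqP => [->|_] //; case: eqP => [->|].
by case: tpermP => [->|->|/eqP/negPf-> /eqP/negPf->] //; rewrite ?eqxx ?(negPf ne_ij).
Qed.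

Lemma alternating_perm w v (s : 'S_e) : alternating w ->
  w [ffun l => v (s l)] = (-1) ^+ s *: w v.
Proof.
move=> w_alt; case: (prod_tpermP s) => ts -> {s}; elim: ts v => [|[i j] ts IHts] v.
  rewrite big_nil odd_perm1 scale1r => _; congr w.
  by apply/ffunP => l; rewrite ffunE perm1.
rewrite big_cons /= => /andP [ne_ij tsP]; set s := (\prod_(_ <- ts) _)%g.
rewrite odd_mul_tperm ne_ij signrN scaleNr -IHts // -(alternating_tperm _ w_alt ne_ij).
by congr w; apply/ffunP => l; rewrite !ffunE permM.
Qed.

End Alternating.

Section DetForm.
Variables (R : comNzRingType) (E : lmodType R) (e : nat) (f : {linear E -> 'rV[R]_e}).

(** The value on the decomposable element with factors [v i] of the e-th exterior power of f, the
    top exterior power of R^e being identified with R. *)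
Definition det_form (v : 'I_e -> E) : R := \det (\matrix_(i, j) f (v i) 0 j).

Lemma det_form_alternating :
  @alternating R E R^o e (fun v => det_form v).
Proof.
split=> [i v c y z upd|v i j ne_ij eq_v]; last first.
  by apply: (determinant_alternate ne_ij) => l; rewrite !mxE eq_v.
rewrite /det_form -[\det (\matrix_(_, _) f (upd z _) _ _)]mul1r.
apply: (determinant_multilinear (i0 := i)).
- by apply/matrixP => a l; rewrite !mxE !ffunE eqxx mul1r linearP !mxE.
- by apply/matrixP => a l; rewrite !mxE !ffunE eq_sym (negPf (neq_lift _ _)).
- by apply/matrixP => a l; rewrite !mxE !ffunE eq_sym (negPf (neq_lift _ _)).
Qed.

End DetForm.

(** The difference of the two sides is multilinear in the vectors [A j], so it suffices to take
    basis vectors with indices given by h: both sides vanish if h is not injective, and both give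
    the sign if h is a permutation. *)
Lemma alternating_det (R : comNzRingType) (M L : lmodType R) e
    (w : {ffun 'I_e -> M} -> L) (u : 'I_e -> M) (A : 'I_e -> 'rV[R]_e) :
  alternating w ->
  w [ffun j => \sum_i A j 0 i *: u i] =
    \det (\matrix_(i, j) A i 0 j) *: w [ffun i => u i].
Proof.
move=> w_alt; pose row_id : {linear 'rV[R]_e -> 'rV[R]_e} := idfun.
pose G (a : 'rV[R]_e) := \sum_i a 0 i *: u i.
have GP c a1 a2 : G (c *: a1 + a2) = c *: G a1 + G a2.
  rewrite /G scaler_sumr -big_split; apply: eq_bigr => i _ /=.
  by rewrite !mxE scalerDl scalerA.
pose D (v : {ffun 'I_e -> 'rV[R]_e}) :=
  w [ffun j => G (v j)] - det_form row_id v *: w [ffun i => u i].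
have D_lin : multilinear D.
  move=> i v c y z /=; rewrite /D; have [det_lin _] := det_form_alternating row_id.
  have -> : det_form row_id [ffun j => if j == i then c *: y + z else v j] =
      c * det_form row_id [ffun j => if j == i then y else v j] +
      det_form row_id [ffun j => if j == i then z else v j] := det_lin i v c y z.
  have [w_lin _] := w_alt.
  have updG a : [ffun j => G ([ffun j => if j == i then a else v j] j)] =
      ffun_upd [ffun j => G (v j)] i (G a).
    by apply/ffunP => j; rewrite !ffunE; case: eqP.
  by rewrite !updG GP multilinearE // scalerDl scalerBr scalerA opprD addrACA.
suff /eqP : D [ffun j => A j] = 0.
  rewrite /D subr_eq0 => /eqP; rewrite (_ : [ffun j => G _] = [ffun j => G (A j)]).
    move=> ->; congr (_ *: _); congr (\det _).
    by apply/matrixP => i j; rewrite !mxE ffunE.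
  by apply/ffunP => j; rewrite !ffunE.
apply: (multilinear_ind (x := fun i => delta_mx 0 i : 'rV[R]_e) D_lin (N := fun l => l = 0)).
- by split=> // c a b -> ->; rewrite scaler0 addr0.
- move=> h; have Gd i : G (delta_mx 0 i) = u i.
    rewrite /G (bigD1 i) //= mxE !eqxx scale1r big1 ?addr0 // => j /negPf ne.
    by rewrite mxE ne scale0r.
  have [/injectiveP h_inj|/injectivePn [i [j ne_ij eq_h]]] := boolP (injectiveb h); last first.
    have [_ det_alt] := det_form_alternating row_id.
    have [_ w_alt0] := w_alt.
    rewrite /D (det_alt _ _ _ ne_ij) ?ffunE ?eq_h // scale0r subr0.
    by apply: (w_alt0 _ _ _ ne_ij); rewrite !ffunE eq_h.
  have -> : h = perm h_inj :> (_ -> _) by apply/funext => j; rewrite permE.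
  apply/eqP; rewrite subr_eq0; apply/eqP.
  rewrite (_ : [ffun j => G _] = [ffun j => u (perm h_inj j)]); last first.
    by apply/ffunP => j; rewrite !ffunE Gd.
  rewrite (_ : [ffun j => u _] = [ffun j => [ffun i => u i] (perm h_inj j)]); last first.
    by apply/ffunP => j; rewrite !ffunE.
  rewrite alternating_perm //; congr (_ *: _).
  transitivity (\det (perm_mx (perm h_inj) : 'M[R]_e)); first by rewrite det_perm.
  by congr (\det _); apply/matrixP => i j; rewrite !mxE ffunE mxE eqxx eq_sym.
- move=> j; apply/fam_spanP; exists (fun i => A j 0 i).
  by rewrite ffunE [LHS]row_sum_delta.
Qed.

(** * Coordinate matrices and change of generators *)

Lemma generators_mx (R : comNzRingType) (E : lmodType R) n (x : 'I_n -> E) p (y : 'I_p -> E) :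
    (forall u, fam_span x u) ->
  exists V : 'M[R]_(n, p), forall l, y l = \sum_j V j l *: x j.
Proof.
move=> x_gen; have /choice [V VE] l : exists c : 'I_n -> R, y l = \sum_j c j *: x j.
  exact/fam_spanP.
by exists (\matrix_(j, l) V l j) => l; rewrite VE; apply: eq_bigr => j _; rewrite mxE.
Qed.

Lemma generators_mx_mul (R : comNzRingType) (E : lmodType R) n (x : 'I_n -> E) p
    (y : 'I_p -> E) (V : 'M[R]_(n, p)) q (W : 'M[R]_(p, q)) l :
  (forall i, y i = \sum_j V j i *: x j) ->
  \sum_i W i l *: y i = \sum_j (V *m W) j l *: x j.
Proof.
move=> yV; under eq_bigr => i _ do rewrite yV scaler_sumr.
rewrite exchange_big /=; apply: eq_bigr => j _; rewrite mxE scaler_suml.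
by apply: eq_bigr => i _; rewrite scalerA mulrC.
Qed.

Section Coordinates.
Variables (R : comNzRingType) (E : lmodType R) (e : nat) (f : {linear E -> 'rV[R]_e}).

Definition coord_mx n (x : 'I_n -> E) : 'M[R]_(e, n) := \matrix_(i, j) f (x j) 0 i.

Lemma coord_mx_mul n (x : 'I_n -> E) p (V : 'M[R]_(n, p)) :
  coord_mx x *m V = coord_mx (fun l => \sum_j V j l *: x j).
Proof.
apply/matrixP => i l; rewrite !mxE linear_sum summxE; apply: eq_bigr => j _.
by rewrite linearZ !mxE mulrC.
Qed.

Lemma det_coord_mx (v : 'I_e -> E) : \det (coord_mx v) = det_form f v.
Proof. by rewrite -det_tr; congr (\det _); apply/matrixP => i j; rewrite !mxE. Qed.

Lemma colsub_coord_mx n p (x : 'I_n -> E) (h : 'I_p -> 'I_n) :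
  colsub h (coord_mx x) = coord_mx (x \o h).
Proof. by apply/matrixP => i j; rewrite !mxE. Qed.

Lemma coord_mx_relation n (x : 'I_n -> E) p (V : 'M[R]_(n, p)) :
  (forall l, \sum_j V j l *: x j = 0) -> coord_mx x *m V = 0.
Proof.
by move=> V0; rewrite coord_mx_mul; apply/matrixP => i l; rewrite !mxE V0 linear0 mxE.
Qed.

Lemma det_form_minors n (x : 'I_n -> E) v :
  (forall u, fam_span x u) -> minors_ideal e (coord_mx x) (det_form f v).
Proof.
move=> x_gen; have [V VE] := generators_mx v x_gen.
rewrite -det_coord_mx (_ : coord_mx v = coord_mx x *m V); first exact: minors_ideal_mulmx.
by rewrite coord_mx_mul; apply/matrixP => i l; rewrite !mxE VE.
Qed.

Lemma minors_coord_mx n (x : 'I_n -> E) (I : R -> Prop) : is_ideal I ->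
  (forall v : 'I_e -> E, I (det_form f v)) ->
  forall d, minors_ideal e (coord_mx x) d -> I d.
Proof.
move=> idI Idet; apply: minors_ideal_min_cols => // h.
by rewrite colsub_coord_mx det_coord_mx.
Qed.

(** The ideal of e-minors is generated by the values of the determinant form on all of E, hence
    depends on f alone; different presentations are compared through it. *)
Lemma minors_coord_mx_gen n (x : 'I_n -> E) n' (x' : 'I_n' -> E) d :
  (forall u, fam_span x' u) ->
  minors_ideal e (coord_mx x) d -> minors_ideal e (coord_mx x') d.
Proof.
move=> x'_gen; apply: minors_coord_mx; first exact: minors_ideal_submodule.
by move=> v; apply: det_form_minors.
Qed.

Variables (u : 'I_e -> E) (s : R).
Hypothesis split_fu : rank_splitting f u s.

Lemma coord_mx_splitting n (x : 'I_n -> E) (S : 'M[R]_(n, e)) :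
  (forall l, u l = \sum_j S j l *: x j) -> coord_mx x *m S = s%:M.
Proof.
move=> uS; rewrite coord_mx_mul; apply/matrixP => i l.
by rewrite mxE -uS; have [_ -> _] := split_fu; rewrite !mxE eqxx /= eq_sym mulr_natr.
Qed.

(** Evaluate w in two ways at the vectors s v_j, which are the combinations of the [u i] with
    coefficients f(v_j)_i. *)
Lemma splitting_alternating (L : lmodType R) (w : {ffun 'I_e -> E} -> L) v :
  alternating w -> s ^+ e *: w v = det_form f v *: w [ffun i => u i].
Proof.
move=> w_alt; rewrite -(alternating_det u (fun j => f (v j)) w_alt).
have [_ _ fu] := split_fu.
have := alternating_det v (fun j => s *: delta_mx 0 j) w_alt.
rewrite (_ : [ffun i => v i] = v); last by apply/ffunP => i; rewrite ffunE.
rewrite (_ : \matrix_(_, _) _ = s%:M); last first.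
  by apply/matrixP => i j; rewrite !mxE eqxx /= mulr_natr eq_sym.
rewrite det_scalar => <-; congr w; apply/ffunP => j; rewrite !ffunE fu.
rewrite (bigD1 j) //= !mxE !eqxx mulr1 big1 ?addr0 // => i /negPf ne.
by rewrite !mxE ne mulr0 scale0r.
Qed.

End Coordinates.

(** * Extension of scalars for splittings *)

Section SplittingBaseChange.
Variables (A B : comNzRingType) (phi : {rmorphism A -> B}).
Variables (M : lmodType A) (N : lmodType B) (b : {linear M -> N | phi \; *:%R}).
Hypothesis bcN : is_base_change b.
Hypothesis phi_nz : forall s, nonzerodivisor s -> nonzerodivisor (phi s).

Lemma base_change_splitting e (f : {linear M -> 'rV[A]_e}) u s :
    rank_splitting f u s ->
  exists2 f' : {linear N -> 'rV[B]_e}, rank_splitting f' (b \o u) (phi s)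
    & forall v, f' (b v) = map_mx phi (f v).
Proof.
move=> [nzs fuE ufE].
have [|g gE] := @semilinear_map _ _ phi M 'rV[B]_e (fun v => map_mx phi (f v)).
  by move=> c v w; rewrite linearP map_mxD map_mxZ.
have [f' f'E _] := bcN g; have {}f'E v : f' (b v) = map_mx phi (f v) by rewrite f'E gE.
exists f' => //; split=> [|i|v]; first exact: phi_nz.
  by rewrite /= f'E fuE map_mxZ map_delta_mx.
(* Both sides of the identity are made linear maps of v, so that it is enough to compare them on the
   image of [b]. *)
have [|h1 h1E] := @linear_map B N N (fun v => \sum_i f' v 0 i *: (b \o u) i).
  move=> c w1 w2; rewrite scaler_sumr -big_split; apply: eq_bigr => i _ /=.
  by rewrite linearP !mxE scalerDl scalerA.
have [|h2 h2E] := @linear_map B N N (fun v => phi s *: v).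
  by move=> c w1 w2; rewrite scalerDr !scalerA mulrC.
rewrite -h1E -h2E; apply: (base_change_eq bcN) => w; rewrite h1E h2E.
rewrite -[RHS](linearZ_LR b) -ufE linear_sum; apply: eq_bigr => i _.
by rewrite f'E mxE linearZ_LR.
Qed.

Lemma base_change_coord_mx e (f : {linear M -> 'rV[A]_e}) (f' : {linear N -> 'rV[B]_e})
    n (x : 'I_n -> M) :
  (forall v, f' (b v) = map_mx phi (f v)) ->
  coord_mx f' (b \o x) = map_mx phi (coord_mx f x).
Proof. by move=> f'E; apply/matrixP => i j; rewrite !mxE /= f'E mxE. Qed.

End SplittingBaseChange.

(** * The norm and the order determinant as multiples of an ideal of minors *)

Lemma scalar_transfer (R : comNzRingType) (P : lmodType R) (theta h : {linear P -> R^o}) :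
  bijective theta -> exists c : R, forall p, h p = c * theta p.
Proof.
move=> [theta' thetaK thetaK']; exists (h (theta' 1)) => p.
rewrite mulrC -[p in LHS]thetaK -[theta p in LHS]mulr1 -[LHS]/(h _).
rewrite (_ : theta' _ = theta p *: theta' 1) ?linearZ //.
by apply: (can_inj thetaK); rewrite linearZ /= !thetaK'.
Qed.

(** The determinant form induces a linear form on LQ, hence equals c' [theta]; conversely [theta] on
    decomposable elements is c times the determinant form. Comparing at [u], where that form is s^e,
    gives c' c = 1, so that c is cancellable. *)
Lemma fractions_norm (R Q : comNzRingType) (iota : {rmorphism R -> Q})
    (E L : lmodType R) e (f : {linear E -> 'rV[R]_e}) u s n (x : 'I_n -> E)
    (w : {ffun 'I_e -> E} -> L) (LQ : lmodType Q) (b : {linear L -> LQ | iota \; *:%R})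
    (theta : {linear LQ -> Q^o}) :
    is_localization (@nonzerodivisor R) iota ->
    rank_splitting f u s -> (forall v, fam_span x v) ->
    is_exterior_power w -> is_base_change b -> bijective theta ->
  exists2 c : Q, nonzerodivisor c &
    forall z, (exists l, theta (b l) = z) <->
      exists2 d, minors_ideal e (coord_mx f x) d & z = c * iota d.
Proof.
move=> fracQ split_fu x_gen extw bcb theta_bij; have [nzs fuE _] := split_fu.
have [w_alt extP] := extw.
have [D DE _] := extP R^o _ (det_form_alternating f).
have [|G GE] := @semilinear_map _ _ iota L Q^o (fun l => iota (D l)).
  by move=> c l1 l2; rewrite linearP rmorphD rmorphM.
have [h hE _] := bcb Q^o G; have [c' c'E] := scalar_transfer h theta_bij.
have det_theta (v : {ffun 'I_e -> E}) : iota (det_form f v) = c' * theta (b (w v)).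
  by rewrite -c'E hE GE DE.
have [t st] := fractions_unit fracQ (nonzerodivisorX (n := e) nzs).
(* The value of [theta] at the wedge of the [u i], divided by s^e: t is the inverse of s^e in Q. *)
pose c := t * theta (b (w [ffun i => u i])).
have thetaE (v : {ffun 'I_e -> E}) : theta (b (w v)) = c * iota (det_form f v).
  have := splitting_alternating split_fu v w_alt => /(congr1 (fun l => t * theta (b l))).
  have theta_bZ a l : theta (b (a *: l)) = iota a * theta (b l).
    by rewrite linearZ_LR /= linearZ.
  rewrite !theta_bZ mulrA [t * _]mulrC st mul1r => ->.
  by rewrite /c mulrCA mulrC.
have cc' : c' * c = 1.
  have det_u : det_form f u = s ^+ e.
    rewrite -det_coord_mx -(det_scalar e s); congr (\det _).
    by apply/matrixP => i j; rewrite !mxE fuE !mxE eqxx eq_sym mulr_natr.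
  have := det_theta [ffun i => u i]; rewrite thetaE.
  rewrite (_ : det_form f _ = s ^+ e); last first.
    by rewrite -det_u; congr (\det _); apply/matrixP => i j; rewrite !mxE ffunE.
  move=> /(congr1 (fun z => z * t)); rewrite st => ->.
  by rewrite -!mulrA st mulr1.
exists c => [z cz|z]; first by rewrite -[z]mul1r -cc' -mulrA cz mulr0.
have idE : is_ideal (fun d => exists l, theta (b l) = c * iota d).
  split; first by exists 0; rewrite !linear0 rmorph0 mulr0.
  move=> a d1 d2 [l1 E1] [l2 E2]; exists (a *: l1 + l2).
  by rewrite linearP linearP /= E1 E2 rmorphD rmorphM mulrDr mulrCA.
split=> [[l <-]|[d Ed ->]].
  move: l; apply: (exterior_power_ind extw) => [|v].
    split=> [|a l1 l2 [d1 Ed1 E1] [d2 Ed2 E2]].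
      exists 0; rewrite ?linear0 ?rmorph0 ?mulr0 //.
      by case: (minors_ideal_submodule e (coord_mx f x)).
    exists (a * d1 + d2); first by case: (minors_ideal_submodule e (coord_mx f x)) => _; apply.
    by rewrite linearP linearP /= E1 E2 rmorphD rmorphM mulrDr mulrCA.
  by exists (det_form f v); [exact: det_form_minors | exact: thetaE].
apply: (minors_coord_mx idE) Ed => v; exists (w [ffun i => v i]).
rewrite thetaE; congr (_ * iota (\det _)).
by apply/matrixP => i j; rewrite !mxE ffunE.
Qed.

Lemma norm_minors (R : comNzRingType) (E : lmodType R) e
    (f : {linear E -> 'rV[R]_e}) u s n (x : 'I_n -> E) (Q : comAlgType R) (N : Q -> Prop) :
    rank_splitting f u s -> (forall v, fam_span x v) ->
    total_ring_of_fractions Q -> is_norm E e N ->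
  exists2 c : Q, nonzerodivisor c &
    forall z, N z <-> exists2 d, minors_ideal e (coord_mx f x) d & z = d *: c.
Proof.
move=> split_fu x_gen fracQ [L [w [LQ [b [theta [extw bcb theta_bij NE]]]]]].
have [c nzc cE] := fractions_norm fracQ split_fu x_gen extw bcb theta_bij.
exists c => // z; rewrite NE cE; split=> [] [d Ed ->]; exists d => //.
  by rewrite /= -scalerAr mulr1.
by rewrite /= -scalerAr mulr1.
Qed.

Lemma order_determinant_minors (R : comNzRingType) (E : lmodType R) e
    (f : {linear E -> 'rV[R]_e}) n (x : 'I_n -> E) (D : R -> Prop) :
    (forall v, fam_span x v) -> is_order_determinant f D ->
  exists2 c : R, nonzerodivisor c &
    forall z, D z <-> exists2 d, minors_ideal e (coord_mx f x) d & z = c * d.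
Proof.
move=> x_gen [_ [L [P [w [w' [F [theta [extw [w'_alt extP] FE theta_bij DE]]]]]]]].
pose row_id : {linear 'rV[R]_e -> 'rV[R]_e} := idfun.
pose basis : 'I_e -> 'rV[R]_e := fun i => delta_mx 0 i.
have [h hE _] := extP R^o _ (det_form_alternating row_id).
have [c' c'E] := scalar_transfer h theta_bij.
pose c := theta (w' [ffun i => basis i]).
have thetaE (v : {ffun 'I_e -> E}) : theta (F (w v)) = c * det_form f v.
  have -> : F (w v) = det_form f v *: w' [ffun i => basis i].
    rewrite FE -(alternating_det basis (fun i => f (v i)) w'_alt); congr w'.
    by apply/ffunP => j; rewrite !ffunE [LHS]row_sum_delta.
  by rewrite linearZ /= mulrC.
have cc' : c' * c = 1.
  rewrite -c'E hE /det_form -[RHS](det1 R e); congr (\det _).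
  by apply/matrixP => i j; rewrite !mxE ffunE mxE eqxx eq_sym.
exists c => [z cz|z]; first by rewrite -[z]mul1r -cc' -mulrA cz mulr0.
have idE : is_ideal (fun d => exists l, theta (F l) = c * d).
  split; first by exists 0; rewrite !linear0 mulr0.
  move=> a d1 d2 [l1 E1] [l2 E2]; exists (a *: l1 + l2).
  by rewrite !linearP /= E1 E2 mulrDr mulrCA.
rewrite DE; split=> [[l <-]|[d Ed ->]].
  move: l; apply: (exterior_power_ind extw) => [|v].
    split=> [|a l1 l2 [d1 Ed1 E1] [d2 Ed2 E2]].
      by exists 0; rewrite ?linear0 ?mulr0 //; case: (minors_ideal_submodule e (coord_mx f x)).
    exists (a * d1 + d2); first by case: (minors_ideal_submodule e (coord_mx f x)) => _; apply.
    by rewrite !linearP /= E1 E2 mulrDr mulrCA.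
  by exists (det_form f v); [exact: det_form_minors | exact: thetaE].
apply: (minors_coord_mx idE) Ed => v; exists (w [ffun i => v i]).
rewrite thetaE; congr (_ * \det _).
by apply/matrixP => i j; rewrite !mxE ffunE.
Qed.

(** * Flatness of localizations and of polynomial rings *)

Section Flatness.

Definition multiplicative_set (A : comNzRingType) (S : A -> Prop) :=
  S 1 /\ forall s t, S s -> S t -> S (s * t).

Lemma multiplicative_prod (A : comNzRingType) (S : A -> Prop) (I : finType) (s : I -> A) :
  multiplicative_set S -> (forall i, S (s i)) -> S (\prod_i s i).
Proof. by move=> [S1 SM] Ss; apply: big_ind. Qed.

Section Localization.
Variables (A B : comNzRingType) (S : A -> Prop) (f : {rmorphism A -> B}).
Hypothesis locB : is_localization S f.

Lemma localization_cancel s y : S s -> f s * y = 0 -> y = 0.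
Proof.
move=> Ss sy; have [unitB _ _] := locB; have [t st] := unitB _ Ss.
by rewrite -[y]mul1r -st mulrAC sy mul0r.
Qed.

Lemma localization_nonzerodivisor s : nonzerodivisor s -> nonzerodivisor (f s).
Proof.
move=> nzs y sy; have [_ frac ker0] := locB; have [a [t [St tyE]]] := frac y.
have [|w Sw wsa] := ker0 (s * a); first by rewrite rmorphM -tyE mulrCA sy mulr0.
apply: (localization_cancel St); rewrite tyE; apply: (localization_cancel Sw).
by rewrite -rmorphM (nzs (w * a)) ?rmorph0 // mulrCA.
Qed.

Hypothesis mulS : multiplicative_set S.

Lemma localization_clear (I : finType) (v : I -> B) :
  exists2 s, S s & forall i, exists a, f s * v i = f a.
Proof.
have [_ frac _] := locB.
have /choice [s sP] i : exists s, S s /\ exists a, f s * v i = f a.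
  by have [a [s [Ss sE]]] := frac (v i); exists s; split=> //; exists a.
exists (\prod_i s i) => [|i]; first by apply: multiplicative_prod => // i; case: (sP i).
have [_ [a aE]] := sP i; exists (\prod_(j | j != i) s j * a).
by rewrite (bigD1 i) //= mulrC !rmorphM mulrA [v i * _]mulrC aE mulrC.
Qed.

Lemma localization_annihilator (I : finType) (a : I -> A) :
  (forall i, f (a i) = 0) -> exists2 s, S s & forall i, s * a i = 0.
Proof.
have [_ _ ker0] := locB; move=> fa0.
have /choice [s sP] i : exists s, S s /\ s * a i = 0.
  by have [s] := ker0 _ (fa0 i); exists s.
exists (\prod_i s i) => [|i]; first by apply: multiplicative_prod => // i; case: (sP i).
by rewrite (bigD1 i) //= mulrAC; case: (sP i) => _ ->; rewrite mul0r.
Qed.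

(** Clear the denominators of v to get w over A. Then M w only maps to 0, but some t in S kills it,
    and the hypothesis applies to t w. *)
Lemma localization_flat p q r (M : 'M[A]_(p, q)) (N : 'M[A]_(r, q)) :
  (forall v : 'cV_q, M *m v = 0 -> N *m v = 0) ->
  forall v : 'cV_q, map_mx f M *m v = 0 -> map_mx f N *m v = 0.
Proof.
move=> MN v Mv; have [s Ss /choice [a aE]] := localization_clear (fun j => v j 0).
pose w := \col_j a j; have wE : map_mx f w = f s *: v.
  by apply/matrixP => j l; rewrite !mxE (ord1 l) aE.
have [|t St tMw] := @localization_annihilator _ (fun i => (M *m w) i 0).
  move=> i; have /matrixP/(_ i 0) : map_mx f (M *m w) = 0.
    by rewrite map_mxM wE -scalemxAr Mv scaler0.
  by rewrite !mxE.
have /MN : M *m (t *: w) = 0.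
  by apply/matrixP => i l; rewrite -scalemxAr mxE (ord1 l) tMw mxE.
move=> /(congr1 (map_mx f)); rewrite map_mxM map_mxZ wE map_mx0 -!scalemxAr => Nv.
apply/matrixP => i l; rewrite [RHS]mxE; apply: (localization_cancel Ss).
by apply: (localization_cancel St); have /matrixP/(_ i l) := Nv; rewrite !mxE.
Qed.

End Localization.

(** A linear system with constant coefficients splits into one system over R for each monomial. *)
Lemma mpoly_flat (R : comNzRingType) n p q r (M : 'M[R]_(p, q)) (N : 'M[R]_(r, q)) :
  (forall v : 'cV_q, M *m v = 0 -> N *m v = 0) ->
  forall v : 'cV_q, map_mx (@mpolyC n R) M *m v = 0 -> map_mx (@mpolyC n R) N *m v = 0.
Proof.
move=> MN v Mv; apply/matrixP => i l; apply/mpolyP => a.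
have coefE s (K : 'M[R]_(s, q)) j h :
    ((map_mx (@mpolyC n R) K *m v) j h)@_a = (K *m map_mx (mcoeff a) v) j h.
  by rewrite !mxE raddf_sum; apply: eq_bigr => c _ /=; rewrite !mxE mcoeffCM.
rewrite coefE MN ?mxE ?mcoeff0 //.
by apply/matrixP => j h; rewrite -coefE Mv !mxE mcoeff0.
Qed.

Lemma mpolyC_nonzerodivisor (R : comNzRingType) n (s : R) :
  nonzerodivisor s -> nonzerodivisor (s%:MP_[n]).
Proof.
move=> nzs p sp; apply/mpolyP => a; rewrite mcoeff0; apply: nzs.
by rewrite -mcoeffCM sp mcoeff0.
Qed.

End Flatness.

(** * The Nagata extension: flat and local *)

Section MaximalExtension.
Variables (R : comNzRingType) (m : R -> Prop) (n : nat).
Hypothesis max_m : maximal_ideal m.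
Local Notation mZ := (ext_ideal (@mpolyC n R) m).

Lemma maximal_ideal_prime a b : m (a * b) -> m a \/ m b.
Proof.
have [idm m1 max] := max_m => mab; have [?|nma] := EM (m a); [by left | right].
pose J z := exists c y, m y /\ z = y + c * a.
have idJ : is_ideal J.
  split; first by exists 0, 0; rewrite mul0r addr0; case: idm.
  move=> d _ _ [c1 [y1 [my1 ->]]] [c2 [y2 [my2 ->]]]; exists (d * c1 + c2), (d * y1 + y2).
  split; first by case: idm => _; apply.
  by rewrite [LHS]/(d * (y1 + c1 * a) + _) mulrDr mulrDl addrACA mulrA.
have mJ : subset_of m J by move=> y my; exists 0, y; rewrite mul0r addr0.
have [[c [y [my E]]]|J1] := EM (J 1).
  rewrite -[b]mul1r E mulrDl -mulrA; apply: (@submoduleD R R^o) => //.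
    by rewrite mulrC; apply: (@submoduleZ R R^o).
  exact: (@submoduleZ R R^o).
by case: nma; apply: (max _ idJ mJ J1); exists 1, 0; rewrite mul1r add0r; case: idm.
Qed.

Lemma ext_idealP p : mZ p <-> forall a, m p@_a.
Proof.
have [idm _ _] := max_m; split.
  move: p; apply: (@lspan_min _ {mpoly R[n]}^o) => [|_ [c mc ->] a].
    split=> [a|c p q mp mq a]; first by rewrite mcoeff0; case: idm.
    rewrite mcoeffD; apply: (@submoduleD R R^o) => //.
    rewrite [_ *: _]/(c * p) mcoeffM; apply: (@submodule_sum R R^o) => // k _.
    exact: (@submoduleZ R R^o).
  by rewrite mcoeffC; rewrite mulrC; apply: (@submoduleZ R R^o).
move=> mp; rewrite [p]mpolyE; apply: (@submodule_sum _ {mpoly R[n]}^o).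
  exact: lspan_submodule.
move=> a _; rewrite -mul_mpolyC mulrC; apply: (@submoduleZ _ {mpoly R[n]}^o).
  exact: lspan_submodule.
by apply: (@lspan_mem _ {mpoly R[n]}^o); exists p@_a.
Qed.

(* Discarding the coefficients in m, the leading coefficients are outside m, and
   so is their product. *)
Lemma ext_ideal_prime p q : mZ (p * q) -> mZ p \/ mZ q.
Proof.
have [idm _ _] := max_m => mpq; apply: contrapT => /not_orP [np nq].
pose tr (r : {mpoly R[n]}) : {mpoly R[n]} :=
  \sum_(a <- msupp r | `[< ~ m r@_a >]) r@_a *: 'X_[a].
have trE r a : (tr r)@_a = if `[< ~ m r@_a >] then r@_a else 0.
  rewrite /tr raddf_sum /=.
  under eq_bigr => c _ do rewrite mcoeffZ mcoeffX.
  have [ra|ra] := boolP (a \in msupp r); last first.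
    rewrite (memN_msupp_eq0 ra) if_same big_seq_cond big1 // => c /andP [rc _].
    by case: eqP => [ca|_]; rewrite ?mulr0 //; move: ra; rewrite -ca rc.
  rewrite big_mkcond (bigD1_seq a) ?msupp_uniq //= eqxx mulr1 big1 ?addr0 // => c /negPf->.
  by rewrite mulr0 if_same.
have tr_lead r : ~ mZ r -> ~ m (mleadc (tr r)).
  move=> nr mr; apply: nr; apply/ext_idealP => a; apply: contrapT => nra.
  have : tr r != 0.
    apply: contra_notN nra => /eqP tr0; have := trE r a; rewrite tr0 mcoeff0.
    by case: asboolP => [_ <-|/contrapT //]; case: idm.
  rewrite -mleadc_eq0 trE; move: mr; rewrite trE.
  by case: asboolP => // _ _; rewrite eqxx.
have tr_sub r a : m (r - tr r)@_a.
  rewrite mcoeffB trE; case: asboolP => [_|/contrapT mra]; last by rewrite subr0.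
  by rewrite subrr; case: idm.
have mulE : tr p * tr q = p * q - (p - tr p) * q - tr p * (q - tr q).
  by rewrite mulrBl opprB addrCA subrr addr0 mulrBr opprB addrCA subrr addr0.
have : m (tr p * tr q)@_(mlead (tr p) + mlead (tr q)).
  suff /ext_idealP : mZ (tr p * tr q) by apply.
  have subZ : @submodule _ {mpoly R[n]}^o mZ by exact: lspan_submodule.
  have mZN r : mZ r -> mZ (- r).
    by rewrite -mulN1r; apply: (@submoduleZ _ {mpoly R[n]}^o).
  rewrite mulE; apply: (@submoduleD _ {mpoly R[n]}^o) => //.
    apply: (@submoduleD _ {mpoly R[n]}^o) => //; apply: mZN; rewrite mulrC.
    by apply: (@submoduleZ _ {mpoly R[n]}^o) => //; apply/ext_idealP.
  by apply: mZN; apply: (@submoduleZ _ {mpoly R[n]}^o) => //; apply/ext_idealP.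
by rewrite mleadcM => /maximal_ideal_prime [/(tr_lead _ np)|/(tr_lead _ nq)].
Qed.

Lemma ext_ideal_multiplicative : multiplicative_set (fun p => ~ mZ p).
Proof.
split=> [/ext_idealP/(_ 0%MM)|s t ns nt /ext_ideal_prime []//].
by rewrite mcoeff1 eqxx; case: max_m.
Qed.

Variables (R2 : comNzRingType) (iota : {rmorphism {mpoly R[n]} -> R2}).
Hypothesis nagR2 : is_nagata_extension m iota.

Lemma nagata_incl_nonzerodivisor s :
  nonzerodivisor s -> nonzerodivisor (nagata_incl iota s).
Proof.
by move=> nzs; apply: (localization_nonzerodivisor nagR2); apply: mpolyC_nonzerodivisor.
Qed.

Lemma nagata_incl_flat p q r (M : 'M[R]_(p, q)) (N : 'M[R]_(r, q)) :
  (forall v : 'cV_q, M *m v = 0 -> N *m v = 0) ->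
  forall v : 'cV_q, map_mx (nagata_incl iota) M *m v = 0 ->
    map_mx (nagata_incl iota) N *m v = 0.
Proof.
have mapE s (K : 'M[R]_(s, q)) : map_mx (nagata_incl iota) K = map_mx iota (map_mx (@mpolyC n R) K).
  by apply/matrixP => i j; rewrite !mxE.
move=> /(@mpoly_flat _ n) MN v; rewrite !mapE.
exact: (localization_flat nagR2 ext_ideal_multiplicative MN).
Qed.

Definition nonunit (A : comNzRingType) (y : A) := ~ exists t, y * t = 1.

(** If p / w had an inverse a / c, some w' outside m R' would satisfy w' w c = w' p a, which lies
    outside m R' by primality and inside it because p does. *)
Lemma nagata_nonunitP y :
  nonunit y <-> exists p w, [/\ mZ p, ~ mZ w & iota w * y = iota p].
Proof.
have [unit frac ker0] := nagR2; have [_ mulS] := ext_ideal_multiplicative.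
split=> [ny|[p [w [mp nw wy]]] [t yt]].
  have [p [w [nw wy]]] := frac y; exists p, w; split=> //.
  apply: contrapT => np; apply: ny; have [t pt] := unit _ np.
  by exists (iota w * t); rewrite mulrA [y * _]mulrC wy.
have [a [c [nc ct]]] := frac t.
have [|w' nw' E] := ker0 (w * c - p * a).
  by rewrite rmorphB !rmorphM -ct -wy mulrACA yt mulr1 subrr.
have /eqP := E; rewrite mulrBr subr_eq0 => /eqP E'.
apply: (mulS _ _ nw' (mulS _ _ nw nc)); rewrite E' [p * a]mulrC mulrA.
by apply: (@submoduleZ _ {mpoly R[n]}^o); first exact: lspan_submodule.
Qed.

(** The form in which locality of R'' is used; a common denominator reduces it to m R' being a prime
    ideal. *)
Lemma nagata_nonunit_ideal : is_ideal (@nonunit R2).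
Proof.
have [_ frac _] := nagR2; have [S1 mulS] := ext_ideal_multiplicative.
have subZ : @submodule _ {mpoly R[n]}^o mZ by exact: lspan_submodule.
apply: is_ideal_intro => [[t]|c y1 y2].
  by rewrite mul0r => /eqP; rewrite eq_sym oner_eq0.
move=> /nagata_nonunitP [p1 [w1 [mp1 nw1 E1]]] /nagata_nonunitP [p2 [w2 [mp2 nw2 E2]]].
have [a [w [nw wc]]] := frac c; apply/nagata_nonunitP.
exists ((a * w2) * p1 + (w * w1) * p2), (w * w1 * w2); split.
- by apply: (@submoduleD _ {mpoly R[n]}^o) => //; apply: (@submoduleZ _ {mpoly R[n]}^o).
- by apply: (mulS) => //; apply: mulS.
- by rewrite rmorphD !rmorphM -E1 -E2 -wc; ring.
Qed.

End MaximalExtension.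

(** * Presentations and projective dimension one *)

(** Induction on p: Z is generated by lifts of generators of the ideal of first coordinates,
    together with generators of the part of Z whose first coordinate is 0. *)
Lemma noetherian_submodule (R : comNzRingType) p (Z : 'cV[R]_p -> Prop) :
  noetherian R -> submodule Z ->
  exists q (A : 'M[R]_(p, q)), forall c, Z c <-> exists v, c = A *m v.
Proof.
move=> noethR; elim: p => [|p IHp] in Z *; move=> subZ; have [Z0 Zlin] := subZ.
  exists 0%N, 0 => c; rewrite (flatmx0 c); split=> // _.
  by exists 0; rewrite mulmx0.
pose J (a : R) := exists2 z : 'cV[R]_(1 + p), Z z & z 0 0 = a.
have [|n [a aP]] := noethR J.
  apply: is_ideal_intro => [|c _ _ [z1 Zz1 <-] [z2 Zz2 <-]]; first by exists 0; rewrite ?mxE.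
  by exists (c *: z1 + z2); [apply: Zlin | rewrite !mxE].
have /choice [z zP] i : exists z : 'cV[R]_(1 + p), Z z /\ z 0 0 = a i.
  by have [|z] := (aP (a i)).2; [apply: lspan_mem; exists i | exists z].
have [|q [A AP]] := IHp (fun c => Z (col_mx 0 c : 'cV_(1 + p))).
  split=> [|c z1 z2 Zz1 Zz2]; first by rewrite col_mx0.
  by rewrite -[0](addr0 (0 : 'cV_1)) -{1}[0](scaler0 _ c) -add_col_mx -scale_col_mx; apply: Zlin.
exists (n + q)%N, (row_mx (\matrix_(i, j) z j i 0) (col_mx (0 : 'M_(1, q)) A) : 'M_(1 + p, _)).
have genE v1 v2 : (row_mx (\matrix_(i, j) z j i 0) (col_mx (0 : 'M_(1, q)) A) : 'M_(1 + p, _)) *m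
    col_mx v1 v2 = \sum_j v1 j 0 *: z j + (col_mx 0 (A *m v2) : 'cV_(1 + p)).
  rewrite mul_row_col mul_col_mx mul0mx; congr (_ + _).
  apply/matrixP => i l; rewrite mxE summxE; apply: eq_bigr => j _.
  by rewrite !mxE (ord1 l) mulrC.
move=> c; split=> [Zc|[v ->]].
  have /aP/fam_spanP [r rE] : J (c 0 0) by exists c.
  pose c' : 'cV[R]_(1 + p) := - (\sum_j r j *: z j) + c.
  have Zc' : Z c'.
    rewrite /c' -scaleN1r; apply: Zlin => //; apply: submodule_sum => // j _.
    by apply: submoduleZ => //; case: (zP j).
  have c'E : c' = col_mx 0 (dsubmx c').
    rewrite -[LHS]vsubmxK; congr col_mx; apply/matrixP => i l.
    rewrite !mxE !ord1 (_ : lshift p 0 = 0) ?rE; last exact: val_inj.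
    rewrite summxE addrC; apply/eqP; rewrite subr_eq0; apply/eqP/eq_bigr => j _.
    by rewrite mxE; case: (zP j) => _ ->.
  have /AP [v' v'E] : Z (col_mx 0 (dsubmx c') : 'cV_(1 + p)) by rewrite -c'E.
  exists (col_mx (\col_j r j) v'); rewrite genE -v'E -c'E.
  rewrite /c' addrA; under eq_bigr => j _ do rewrite mxE.
  by rewrite subrr add0r.
rewrite -[v]vsubmxK genE; apply: submoduleD => //.
  apply: submodule_sum => // j _.
  by apply: submoduleZ => //; case: (zP j).
by apply/AP; exists (dsubmx v).
Qed.

Lemma noetherian_presentation (R : comNzRingType) (E : lmodType R) :
  noetherian R -> finitely_generated E ->
  exists p q (y : 'I_p -> E) (A : 'M[R]_(p, q)), is_presentation y A.
Proof.
move=> noethR [p [y y_gen]].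
have [|q [A AP]] := @noetherian_submodule R p (fun c => \sum_j c j 0 *: y j = 0) noethR.
  split=> [|c z1 z2 E1 E2]; first by rewrite big1 // => j _; rewrite mxE scale0r.
  transitivity (c *: (\sum_j z1 j 0 *: y j) + \sum_j z2 j 0 *: y j).
    rewrite scaler_sumr -big_split; apply: eq_bigr => j _ /=.
    by rewrite !mxE scalerDl scalerA.
  by rewrite E1 E2 scaler0 addr0.
by exists p, q, y, A; split.
Qed.

Section Presentations.
Variables (R : comNzRingType) (E : lmodType R).

Lemma presentation_relation p q (y : 'I_p -> E) (A : 'M[R]_(p, q)) l :
  is_presentation y A -> \sum_i A i l *: y i = 0.
Proof.
move=> [_ presA]; have /presA E0 : exists v, col l A = A *m v.
  by exists (delta_mx l 0); rewrite colE.
by rewrite -[RHS]E0; apply: eq_bigr => i _; rewrite mxE.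
Qed.

Lemma presentation_mx p q (y : 'I_p -> E) (A : 'M[R]_(p, q)) t (V : 'M[R]_(p, t)) :
  is_presentation y A -> (forall l, \sum_i V i l *: y i = 0) ->
  exists W, V = A *m W.
Proof.
move=> [_ presA] V0.
have /choice [W WE] l : exists v, col l V = A *m v.
  by apply/presA; rewrite -[RHS](V0 l); apply: eq_bigr => i _; rewrite mxE.
exists (\matrix_(i, l) W l i 0); apply/matrixP => i l.
have /matrixP/(_ i 0) := WE l; rewrite !mxE => ->.
by apply: eq_bigr => j _; rewrite mxE.
Qed.

(* The column space of A is projective: eps is the matrix of v |-> sigma (A v),
   where sigma splits the surjection A onto it. *)
Definition split_columns p q (A : 'M[R]_(p, q)) (eps : 'M[R]_q) :=
  A *m eps = A /\ forall v : 'cV_q, A *m v = 0 -> eps *m v = 0.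

(** A comparison of resolutions as in Schanuel's lemma. Lift the two surjections onto E through each
    other, by [beta] : P -> R^p and [alpha] : R^p -> P; as K is projective, [beta] on K lifts to [h]
    : K -> R^q, and 1 - beta alpha factors as A W. *)
Lemma projdim1_split_columns p q (y : 'I_p -> E) (A : 'M[R]_(p, q)) :
  is_presentation y A -> projdim_le E 1 -> exists eps, split_columns A eps.
Proof.
move=> presA [P [K [i [pr [projP i_inj pr_surj pr_ker projK]]]]].
have [y_gen relA] := presA.
have [|pi piE] := @linear_map R 'cV[R]_p E (fun c => \sum_j c j 0 *: y j).
  move=> c z1 z2; rewrite scaler_sumr -big_split; apply: eq_bigr => j _ /=.
  by rewrite !mxE scalerDl scalerA.
have piA v : pi (A *m v) = 0 by rewrite piE; apply/relA; exists v.
have pi_ker c : pi c = 0 -> exists v, c = A *m v by rewrite piE => /relA.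
have [|beta betaE] := projP 'cV[R]_p E pi pr.
  move=> u; have /fam_spanP [c ->] := y_gen u; exists (\col_j c j).
  by rewrite piE; apply: eq_bigr => j _; rewrite mxE.
have /choice [al alE] j : exists u, pr u = y j by apply: pr_surj.
have [|alpha alphaE] := @linear_map R 'cV[R]_p P (fun c => \sum_j c j 0 *: al j).
  move=> c z1 z2; rewrite scaler_sumr -big_split; apply: eq_bigr => j _ /=.
  by rewrite !mxE scalerDl scalerA.
have pr_alpha c : pr (alpha c) = pi c.
  by rewrite alphaE piE linear_sum; apply: eq_bigr => j _; rewrite linearZ /= alE.
have [h hE] : exists h : {linear K -> 'cV[R]_q}, forall k, A *m h k = beta (i k).
  (* The quotient of R^q by the kernel of A stands for the column space of A. *)
  have [|C [pq [pq_surj pq_ker]]] := @quotient_module R 'cV[R]_q (fun v => A *m v = 0).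
    split=> [|c z1 z2 E1 E2]; first by rewrite mulmx0.
    by rewrite mulmxDr -scalemxAr E1 E2 scaler0 addr0.
  have /choice [v vE] k : exists v, beta (i k) = A *m v.
    by apply: pi_ker; rewrite betaE; apply/pr_ker; exists k.
  have pq_eq v1 v2 : pq v1 = pq v2 <-> A *m v1 = A *m v2.
    split=> [E12|E12]; apply/eqP; rewrite -subr_eq0; apply/eqP.
      by rewrite -mulmxBr; apply/pq_ker; rewrite linearB E12 subrr.
    by rewrite -linearB; apply/pq_ker; rewrite mulmxBr E12 subrr.
  have [|hC hCE] := @linear_map R K C (fun k => pq (v k)).
    move=> c k1 k2; rewrite -linearP; apply/pq_eq.
    by rewrite mulmxDr -scalemxAr -!vE !linearP.
  have [h hE] := projK _ _ pq hC pq_surj.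
  by exists h => k; rewrite vE; apply/pq_eq; rewrite hE hCE.
have /choice [k kE] l : exists k, i k = alpha (col l A).
  have [|k kE] := (pr_ker (alpha (col l A))).1; last by exists k.
  by rewrite pr_alpha colE piA.
have /choice [w wE] j : exists w, delta_mx j 0 - beta (alpha (delta_mx j 0)) = A *m w.
  by apply: pi_ker; rewrite linearB /= betaE pr_alpha subrr.
pose W := \matrix_(l, j) w j l 0.
have WE c : A *m (W *m c) = c - beta (alpha c).
  have WcE : W *m c = \sum_j c j 0 *: w j.
    apply/matrixP => l a; rewrite mxE summxE; apply: eq_bigr => j _.
    by rewrite !mxE (ord1 a) mulrC.
  have cE : c = \sum_j c j 0 *: delta_mx j 0.
    by rewrite {1}[c]matrix_sum_delta; apply: eq_bigr => j _; rewrite big_ord1.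
  have -> : beta (alpha c) = \sum_j c j 0 *: beta (alpha (delta_mx j 0)).
    by rewrite {1}cE linear_sum linear_sum; apply: eq_bigr => j _; rewrite !linearZ.
  rewrite [X in X - _]cE -sumrB WcE mulmx_sumr; apply: eq_bigr => j _.
  by rewrite -scalerBr wE scalemxAr.
(* The section of A sends z to h (i^-1 (alpha z)) + W z, and A maps this to beta alpha z + (z - beta
   alpha z) = z; eps is its composite with A. *)
exists (\matrix_(a, l) (h (k l)) a 0 + W *m A); split.
  apply/matrixP => a l; rewrite mulmxDr.
  have -> : A *m (\matrix_(a, l) (h (k l)) a 0) = \matrix_(a, l) beta (i (k l)) a 0.
    by apply/matrixP => c d; rewrite !mxE -hE mxE; apply: eq_bigr => j _; rewrite mxE.
  have -> : A *m (W *m A) = \matrix_(a, l) (A *m (W *m col l A)) a 0.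
    by apply/matrixP => c d; rewrite [RHS]mxE colE !mulmxA -colE [RHS]mxE.
  by rewrite [LHS]mxE [X in X + _]mxE [X in _ + X]mxE WE kE !mxE addrCA subrr addr0.
move=> v Av; rewrite mulmxDl -mulmxA Av mulmx0 addr0.
have -> : (\matrix_(a, l) (h (k l)) a 0) *m v = h (\sum_l v l 0 *: k l).
  rewrite linear_sum; apply/matrixP => a c; rewrite mxE summxE.
  by apply: eq_bigr => l _; rewrite linearZ !mxE (ord1 c) mulrC.
rewrite (_ : \sum_l _ = 0) ?linear0 //; apply: i_inj; rewrite linear0 linear_sum.
transitivity (alpha (A *m v)); last by rewrite Av linear0.
have -> : A *m v = \sum_l v l 0 *: col l A.
  apply/matrixP => a c; rewrite mxE summxE; apply: eq_bigr => l _.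
  by rewrite !mxE (ord1 c) mulrC.
by rewrite linear_sum; apply: eq_bigr => l _; rewrite !linearZ /= kE.
Qed.

(** The changes of generators satisfy 1 - B C = phi W, so the section carried over through V and Y
    misses the identity on the columns of [phi] by phi W phi, which the term W phi restores. *)
Lemma split_columns_transport n q p r (x : 'I_n -> E) (phi : 'M[R]_(n, q))
    (y : 'I_p -> E) (A : 'M[R]_(p, r)) eps :
  is_presentation x phi -> is_presentation y A -> split_columns A eps ->
  exists eps', split_columns phi eps'.
Proof.
move=> presx presy [Aeps epsA].
have [C xC] := generators_mx x presy.1; have [B yB] := generators_mx y presx.1.
have [Y CphiE] : exists Y, C *m phi = A *m Y.
  apply: (presentation_mx presy) => l; rewrite -(generators_mx_mul phi l xC).
  exact: presentation_relation presx.
have [V BAE] : exists V, B *m A = phi *m V.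
  apply: (presentation_mx presx) => l; rewrite -(generators_mx_mul A l yB).
  exact: presentation_relation presy.
have [W WE] : exists W, 1%:M - B *m C = phi *m W.
  apply: (presentation_mx presx) => l.
  transitivity (\sum_j (1%:M : 'M_n) j l *: x j - \sum_j (B *m C) j l *: x j).
    by rewrite -sumrB; apply: eq_bigr => j _; rewrite mxE [X in _ + X]mxE scalerBl.
  rewrite -(generators_mx_mul C l yB) -xC (bigD1 l) //= mxE eqxx scale1r.
  by rewrite big1 ?addr0 ?subrr // => j /negPf ne; rewrite mxE ne scale0r.
exists (V *m eps *m Y + W *m phi); split=> [|v phiv].
  rewrite mulmxDr !mulmxA -BAE -[B *m A *m eps]mulmxA Aeps -[B *m A *m Y]mulmxA -CphiE.
  by rewrite -WE mulmxBl mul1mx mulmxA addrCA subrr addr0.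
rewrite mulmxDl -!mulmxA phiv mulmx0 addr0 epsA ?mulmx0 //.
by rewrite mulmxA -CphiE -mulmxA phiv mulmx0.
Qed.

End Presentations.

Lemma base_change_presentation (A B : comNzRingType) (phi : {rmorphism A -> B})
    (M : lmodType A) (N : lmodType B) (b : {linear M -> N | phi \; *:%R})
    p q (y : 'I_p -> M) (D : 'M[A]_(p, q)) :
  is_base_change b -> is_presentation y D ->
  is_presentation (b \o y) (map_mx phi D).
Proof.
move=> bcb [y_gen relD]; split=> [|c]; first exact: base_change_gen.
split=> [/(base_change_rel bcb y_gen)|[v ->]].
  move: c; apply: lspan_min => [|_ [r /relD [v ->] ->]]; last first.
    by exists (map_mx phi v); rewrite map_mxM.
  split=> [|c _ _ [v1 ->] [v2 ->]]; first by exists 0; rewrite mulmx0.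
  by exists (c *: v1 + v2); rewrite mulmxDr -scalemxAr.
have -> : \sum_i (map_mx phi D *m v) i 0 *: (b \o y) i =
    \sum_l v l 0 *: b (\sum_i D i l *: y i).
  under eq_bigr => i _ do rewrite mxE scaler_suml.
  rewrite exchange_big /=; apply: eq_bigr => l _; rewrite linear_sum scaler_sumr.
  by apply: eq_bigr => i _; rewrite mxE linearZ_LR /= scalerA mulrC.
rewrite big1 // => l _; rewrite (@presentation_relation _ _ _ _ _ D) ?linear0 ?scaler0 //.
Qed.

(** * Irredundant columns over a local ring *)

Section LocalColumns.
Variables (R : comNzRingType).
Hypothesis nonunit_ideal : is_ideal (@nonunit R).

Lemma det_near1_unit n (A : 'M[R]_n) :
  (forall i j, nonunit ((1%:M - A) i j)) -> exists t, \det A * t = 1.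
Proof.
move=> nearA; apply: contrapT => ndet.
suff : nonunit (1 : R) by case; exists 1; rewrite mulr1.
have cong (x y x' y' : R) : nonunit (x - y) -> nonunit (x' - y') ->
    nonunit (x * x' - y * y').
  move=> nxy nxy'; rewrite (_ : _ - _ = x' * (x - y) + y * (x' - y')); last by ring.
  by apply: (@submoduleD R R^o (@nonunit R)) => //; apply: (@submoduleZ R R^o (@nonunit R)).
have n0 : nonunit (0 : R) by case: nonunit_ideal.
have : nonunit (\det (1%:M : 'M[R]_n) - \det A).
  rewrite /determinant -sumrB; apply: (@submodule_sum R R^o (@nonunit R)) => // s _.
  rewrite -mulrBr; apply: (@submoduleZ R R^o (@nonunit R)) => //.
  apply: (big_ind2 (fun x y => nonunit (x - y))) => [|x y x' y'|i _].
  - by rewrite subrr.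
  - by move=> nxx' nyy'; apply: cong.
  - by have := nearA i (s i); rewrite !mxE.
rewrite det1 => n1A; rewrite -(subrK (\det A) 1).
by apply: (@submoduleD R R^o (@nonunit R)).
Qed.

Lemma minimal_columns_nonunit p q (A : 'M[R]_(p, q)) (v : 'cV_q) j :
  minimal_columns A -> A *m v = 0 -> nonunit (v j 0).
Proof.
move=> minA Av [t vt]; apply: (minA j); exists (delta_mx j 0 - t *: v).
by rewrite !mxE !eqxx mulrC vt subrr mulmxBr -scalemxAr Av scaler0 subr0 colE.
Qed.

(** Nakayama's lemma for matrices: the columns of 1 - eps are relations between the columns of A, so
    irredundancy makes their entries nonunits and det eps a unit, whereas eps v = 0. *)
Lemma minimal_split_columns_inj p q (A : 'M[R]_(p, q)) eps (v : 'cV_q) :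
  minimal_columns A -> split_columns A eps -> A *m v = 0 -> v = 0.
Proof.
move=> minA [Aeps epsA] /epsA epsv.
have [|t dett] := @det_near1_unit _ eps.
  move=> i j; have := @minimal_columns_nonunit _ _ A (col j (1%:M - eps)) i minA.
  rewrite [col j _ _ _]mxE; apply.
  by rewrite colE mulmxA mulmxBr mulmx1 Aeps subrr mul0mx.
rewrite -[v]scale1r -dett mulrC -scalerA (_ : \det eps *: v = 0) ?scaler0 //.
by rewrite -mul_scalar_mx -mul_adj_mx -mulmxA epsv mulmx0.
Qed.

End LocalColumns.

(** * Grade one, and maps whose image has rank e *)

Lemma grade1_nonzerodivisor (R : comNzRingType) (I : R -> Prop) :
  grade_ge I 1 -> exists2 s, nonzerodivisor s & I s.
Proof.
case=> [I1|[a [[reg _] Ia]]]; first by exists 1; [exact: nonzerodivisor1|].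
exists (a ord0) => // y ay.
(* No term precedes the first one, so the ideal in the regularity condition is 0. *)
have [n [c [z [z0 ->]]]] : ideal_gen (fun z => exists2 j : 'I_1, (j < @ord0 0)%N & z = a j) y.
  by apply: (reg ord0); rewrite ay; exact: (@lspan_submodule R R^o _).1.
by rewrite big1 // => i _; case: (z0 i) => -[].
Qed.

(** The vectors [u i] are linearly independent because f maps them to s times the standard basis;
    the injective [i] keeps them independent, and McCoy's theorem applies. *)
Lemma det_form_nonzerodivisor (R : comNzRingType) (T : lmodType R) e
    (f : {linear T -> 'rV[R]_e}) u s (i : {linear T -> 'rV[R]_e}) :
  rank_splitting f u s -> injective i -> nonzerodivisor (det_form i u).
Proof.
move=> [nzs fuE _] i_inj; rewrite -det_coord_mx; apply: nonzerodivisor_det => v.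
rewrite coord_mx_mul => /matrixP Mv; apply/matrixP => l a; rewrite [RHS]mxE; apply: nzs.
have E0 : \sum_j v j a *: u j = 0.
  apply: i_inj; rewrite linear0; apply/matrixP => c j.
  by rewrite (ord1 c) [RHS]mxE; have := Mv j a; rewrite !mxE.
have /matrixP/(_ 0 l) : f (\sum_j v j a *: u j) = 0 by rewrite E0 linear0.
rewrite linear_sum summxE (bigD1 l) //= linearZ fuE !mxE !eqxx mulr1 mulrC big1 ?addr0 //.
by move=> j /negPf ne; rewrite linearZ fuE !mxE eq_sym ne !mulr0.
Qed.

(** Through the image T, with its own splitting f', u', s', one has s'^e det f(u0) = det f'(p u0)
    det i(u'). The first factor on the right divides s0^e s'^e, by evaluation at lifts of u' to
    E. *)
Lemma image_rank_det_form (R : comNzRingType) (E : lmodType R) e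
    (f0 : {linear E -> 'rV[R]_e}) u0 s0 (f : {linear E -> 'rV[R]_e}) :
  finitely_generated E -> rank_splitting f0 u0 s0 -> image_has_rank f e ->
  nonzerodivisor (det_form f u0).
Proof.
move=> [p0 [y y_gen]] split0 [T [p [i [p_surj i_inj fE rankT]]]].
have fgT : finitely_generated T.
  exists p0, (p \o y) => t; have [v <-] := p_surj t; have /fam_spanP [c ->] := y_gen v.
  by apply/fam_spanP; exists c; rewrite linear_sum; apply: eq_bigr => j _; rewrite linearZ.
have [f' [u' [s' split']]] := has_rank_splitting fgT rankT.
have [nzs0 _ _] := split0; have [nzs' f'u' _] := split'.
have /choice [v vE] l : exists v, p v = u' l by apply: p_surj.
have [|f'p f'pE] := @linear_map R E 'rV[R]_e (f' \o p).
  by move=> c w1 w2 /=; rewrite !linearP.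
have eq_form (V W : lmodType R) (h1 : {linear V -> 'rV[R]_e})
    (h2 : {linear W -> 'rV[R]_e}) w w' :
    (forall l, h1 (w l) = h2 (w' l)) -> det_form h1 w = det_form h2 w'.
  by move=> eqh; congr (\det _); apply/matrixP => a l; rewrite !mxE eqh.
have nz1 : nonzerodivisor (det_form f' (p \o u0)).
  have := splitting_alternating split0 (finfun v) (det_form_alternating f'p).
  have -> : det_form f'p (finfun v) = s' ^+ e.
    rewrite -(det_scalar e s'); congr (\det _); apply/matrixP => a l.
    by rewrite !mxE ffunE f'pE /= vE f'u' !mxE eqxx eq_sym mulr_natr.
  move=> E1; apply: (@nonzerodivisor_divl _ _ (det_form f0 (finfun v))).
  suff -> : det_form f' (p \o u0) * det_form f0 (finfun v) = s0 ^+ e * s' ^+ e.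
    by apply: nonzerodivisorM; apply: nonzerodivisorX.
  rewrite mulrC [RHS]E1; congr (_ * _); apply: eq_form => // l.
  by rewrite ffunE f'pE.
have := splitting_alternating split' (finfun (p \o u0)) (det_form_alternating i).
set d := det_form i (finfun _); have -> : det_form f u0 = d.
  by apply: eq_form => // l; rewrite ffunE fE.
move=> E2; apply: (@nonzerodivisor_divl _ _ (s' ^+ e)); rewrite mulrC [_ * _]E2.
apply: nonzerodivisorM.
  by rewrite (@eq_form _ _ f' f' _ (p \o u0)) // => l; rewrite ffunE.
rewrite (@eq_form _ _ i i _ u') => [|l]; last by rewrite ffunE.
exact: det_form_nonzerodivisor split' i_inj.
Qed.

(** * Minors of relation matrices and the isomorphisms of the theorem *)

Section RelationMinors.
Variables (R : comNzRingType) (E : lmodType R) (e : nat).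
Variables (f : {linear E -> 'rV[R]_e}) (u : 'I_e -> E) (s : R).
Hypothesis split_fu : rank_splitting f u s.
Variables (n k : nat) (x : 'I_n -> E).
Hypothesis x_gen : forall v, fam_span x v.

Lemma relation_minors_complement (rho : 'M[R]_(n, k)) :
    n = (e + k)%N -> (forall l, \sum_i rho i l *: x i = 0) ->
  exists beta, (forall y, minors_ideal k rho y ->
      exists2 d, minors_ideal e (coord_mx f x) d & s ^+ e * y = beta * d) /\
    (forall d, minors_ideal e (coord_mx f x) d ->
      exists2 y, minors_ideal k rho y & s ^+ e * y = beta * d).
Proof.
move=> nE; subst n => rho0; have [S uS] := generators_mx u x_gen.
have PS := coord_mx_splitting split_fu uS; have Prho := coord_mx_relation f rho0.
exists (\det (row_mx S rho)); split=> y.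
  exact: minors_complement_rho.
exact: minors_complement_P.
Qed.

Lemma relation_minors_eq0 t (A : 'M[R]_(n, t)) (h : 'I_t -> 'I_n) :
  (n < e + t)%N -> (forall l, \sum_i A i l *: x i = 0) -> \det (rowsub h A) = 0.
Proof.
move=> lt_n A0; have [S uS] := generators_mx u x_gen; have [nzs _ _] := split_fu.
have PS := coord_mx_splitting split_fu uS.
exact: det_relations_eq0 nzs PS (coord_mx_relation f A0) lt_n.
Qed.

End RelationMinors.

(* The square matrix [S | rho] presents E / <u>, whereas the columns of [S' | A]
   need not generate all the relations on the images of x'. *)
Lemma square_presentation_dvd (R : comNzRingType) (E : lmodType R) e (u : 'I_e -> E)
    k (x : 'I_(e + k) -> E) (S : 'M[R]_(e + k, e)) (rho : 'M[R]_(e + k, k))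
    t (x' : 'I_(e + t) -> E) (S' : 'M[R]_(e + t, e)) (A : 'M[R]_(e + t, t)) :
  is_presentation x rho -> (forall l, u l = \sum_j S j l *: x j) ->
  (forall v, fam_span x' v) -> (forall l, u l = \sum_j S' j l *: x' j) ->
  (forall l, \sum_i A i l *: x' i = 0) ->
  exists c, \det (row_mx S' A) = \det (row_mx S rho) * c.
Proof.
move=> presx uS x'_gen uS' A0.
have [C x'C] := generators_mx x' presx.1; have [B xB] := generators_mx x x'_gen.
have [Y1 Y1E] : exists W, C *m S' - S = rho *m W.
  apply: (presentation_mx presx) => l.
  transitivity (\sum_i (C *m S') i l *: x i - \sum_i S i l *: x i).
    by rewrite -sumrB; apply: eq_bigr => j _; rewrite mxE [X in _ + X]mxE scalerBl.
  by rewrite -(generators_mx_mul S' l x'C) -uS -uS' subrr.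
have [Y2 Y2E] : exists W, C *m A = rho *m W.
  apply: (presentation_mx presx) => l.
  by rewrite -(generators_mx_mul A l x'C).
have [W WE] : exists W, 1%:M - C *m B = rho *m W.
  apply: (presentation_mx presx) => l.
  transitivity (\sum_j (1%:M : 'M_(e + k)) j l *: x j - \sum_j (C *m B) j l *: x j).
    by rewrite -sumrB; apply: eq_bigr => j _; rewrite mxE [X in _ + X]mxE scalerBl.
  rewrite -(generators_mx_mul B l x'C) -xB (bigD1 l) //= mxE eqxx scale1r.
  by rewrite big1 ?addr0 ?subrr // => j /negPf ne; rewrite mxE ne scale0r.
pose N := row_mx S rho; pose M := row_mx S' A.
pose Y : 'M[R]_(e + k, e + t) := block_mx 1%:M 0 Y1 Y2.
pose W' : 'M[R]_(e + k) := col_mx 0 W.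
have CM : C *m M = N *m Y.
  rewrite /M /N /Y mul_mx_row mul_row_block !mulmx1 mulmx0 add0r -Y1E -Y2E.
  by rewrite addrCA subrr addr0.
have CB : 1%:M - C *m B = N *m W' by rewrite /N /W' mul_row_col mulmx0 add0r.
(* M and N may differ in size. Bordering by identity blocks gives both sides the same size; the
   determinants are det M on the left and a multiple of det N on the right. *)
have key : block_mx 1%:M 0 C 1%:M *m block_mx M (- B) 0 1%:M =
    block_mx 1%:M 0 0 N *m block_mx M (- B) Y W'.
  rewrite !mulmx_block !mul1mx !mul0mx !addr0 !add0r -CM -CB.
  by rewrite mulmxN addrC.
exists (\det (block_mx M (- B) Y W')).
have := congr1 determinant key.
rewrite !det_mulmx det_lblock !det1 !mul1r det_ublock det1 mulr1 => ->.
by rewrite det_lblock det1 mul1r.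
Qed.

Lemma fitting_ideal_minors (R : comNzRingType) (E : lmodType R) e
    (f : {linear E -> 'rV[R]_e}) u s n k (x : 'I_n -> E) (rho : 'M[R]_(n, k)) y :
  rank_splitting f u s -> n = (e + k)%N -> is_presentation x rho ->
  fitting_ideal E e y -> minors_ideal k rho y.
Proof.
move=> split_fu nE presx; subst n; move=> [p [q [x' [A [presx' yA]]]]].
have [nzs _ _] := split_fu; have nzse := nonzerodivisorX (n := e) nzs.
have [S uS] := generators_mx u presx.1; have [S' uS'] := generators_mx u presx'.1.
(* Otherwise s^e would be the determinant of a product factoring through R^p with p < e. This
   excludes the truncated case p - e = 0 with p < e. *)
have le_ep : (e <= p)%N.
  rewrite leqNgt; apply/negP => lt_pe; have := nzse.
  rewrite -(det_scalar e) -(coord_mx_splitting split_fu uS') det_mulmx_eq0 //.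
  exact: nonzerodivisor_neq0.
have [t pE] : exists t, p = (e + t)%N by exists (p - e)%N; rewrite subnKC.
subst p; move: yA; rewrite addKn; apply: minors_ideal_min; first exact: minors_ideal_submodule.
move=> a c; have Ac0 l : \sum_i (colsub c A) i l *: x' i = 0.
  rewrite -[RHS](presentation_relation (c l) presx').
  by apply: eq_bigr => i _; rewrite mxE.
have [gam gamE] := square_presentation_dvd presx uS presx'.1 uS' Ac0.
have PS' := coord_mx_splitting split_fu uS'.
have [|d' d'P dE] := minors_complement_rho PS' (coord_mx_relation f Ac0)
    (y := \det (mxsub a c A)).
  rewrite (_ : mxsub a c A = mxsub a id (colsub c A)); first exact: minors_ideal_mem.
  by apply/matrixP => i j; rewrite !mxE.
have PS := coord_mx_splitting split_fu uS.
have rho0 l : \sum_i rho i l *: x i = 0 by exact: presentation_relation.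
have [y' y'rho y'E] := minors_complement_P PS (coord_mx_relation f rho0)
    (minors_coord_mx_gen presx.1 d'P).
suff -> : \det (mxsub a c A) = gam * y'.
  by apply: (@submoduleZ R R^o) => //; exact: minors_ideal_submodule.
apply: (nonzerodivisor_inj nzse); rewrite dE gamE [RHS]mulrCA y'E.
by ring.
Qed.

Lemma bourbaki_ideal_iso (R : comNzRingType) (E : lmodType R) e
    (f : {linear E -> 'rV[R]_e}) u s d k q (x : 'I_(d + k.+1) -> E)
    (phi : 'M[R]_(d + k.+1, q)) (g : 'I_k -> 'I_q) sigma (I : R -> Prop) :
  rank_splitting f u s -> (d < e)%N -> is_presentation x phi ->
  nonzerodivisor sigma -> minors_ideal k (dsubmx (colsub g phi)) sigma ->
  is_bourbaki_ideal (fun j => x (lshift k.+1 j)) I ->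
  @submod_iso R R^o R^o I (minors_ideal k (dsubmx (colsub g phi))).
Proof.
move=> split_fu lt_de presx nzsigma sigmaP [_ idI [C [p [p_surj p_ker [F [FI Flin Finj Fsurj]]]]]].
have [x_gen relx] := presx; set psi := dsubmx _ in sigmaP *.
pose comb (c : 'cV[R]_(d + k.+1)) := \sum_j c j 0 *: x j.
have combP a c1 c2 : comb (a *: c1 + c2) = a *: comb c1 + comb c2.
  rewrite /comb scaler_sumr -big_split; apply: eq_bigr => j _ /=.
  by rewrite !mxE scalerDl scalerA.
have comb_low c : dsubmx c = 0 -> p (comb c) = 0.
  move=> c0; apply/p_ker/fam_spanP; exists (fun j => c (lshift k.+1 j) 0).
  rewrite /comb big_split_ord /= [X in _ + X]big1 ?addr0 // => j _.
  by have /matrixP/(_ j 0) := c0; rewrite !mxE => ->; rewrite scale0r.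
have comb_phi v : comb (phi *m v) = 0 by apply/relx; exists v.
have FP a v w : F (a *: v + w) = a * F v + F w by exact: Flin.
have F0 : F 0 = 0.
  by have := FP (-1) 0 0; rewrite scaler0 addr0 mulN1r addNr.
(* A column of [phi] joined to [psi] gives a minor of relations of size k+1, which vanishes because
   d < e makes n < e + (k+1). *)
have sm_phi v : signed_minors psi (dsubmx (phi *m v)) = 0.
  have -> : dsubmx (phi *m v) = \sum_l v l 0 *: dsubmx (col l phi) + 0.
    rewrite addr0; apply/matrixP => i j; rewrite summxE !mxE; apply: eq_bigr => l _.
    by rewrite !mxE (ord1 j) mulrC.
  elim: (index_enum _) => [|l ls IHls]; first by rewrite big_nil addr0 signed_minors0.
  rewrite big_cons -addrA signed_minors_linear IHls addr0 /signed_minors.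
  rewrite (_ : row_mx _ _ =
      rowsub (@rshift d k.+1) (row_mx (col l phi) (colsub g phi) : 'M_(_, 1 + k))).
    rewrite (relation_minors_eq0 split_fu x_gen) ?mulr0 //.
      by rewrite -addSn leq_add2r.
    move=> j; case: (split_ordP j) => a ->.
      under eq_bigr => i _ do rewrite row_mxEl mxE.
      exact: presentation_relation.
    under eq_bigr => i _ do rewrite row_mxEr mxE.
    exact: presentation_relation.
  by apply/matrixP => i j; rewrite !mxE; case: split => a; rewrite !mxE.
(* A combination of the generators with coordinates c is sent to I through the quotient, and to the
   minors through its last k+1 coordinates. *)
pose T (y z : R) := exists c, y = F (p (comb c)) /\ z = signed_minors psi (dsubmx c).
apply: (@submod_iso_rel R R^o R^o _ _ T) => //.
- move=> y /Fsurj [c' _ <-]; have [v <-] := p_surj c'.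
  have /fam_spanP [c cE] := x_gen v; exists (signed_minors psi (dsubmx (\col_j c j))).
    exact: signed_minors_minors.
  exists (\col_j c j); split=> //; congr (F (p _)); rewrite cE.
  by apply: eq_bigr => j _; rewrite mxE.
- move=> z /minors_signed_minors [c2 <-].
  exists (F (p (comb (col_mx 0 c2)))); first exact: FI.
  by exists (col_mx 0 c2); rewrite col_mxKd.
- move=> a y1 z1 y2 z2 [c1 [-> ->]] [c2 [-> ->]]; exists (a *: c1 + c2).
  rewrite combP linearP FP; split=> //.
  by rewrite linearP signed_minors_linear.
- move=> y z [c [-> ->]]; split=> [y0|z0].
    have /p_ker/fam_spanP [a aE] : p (comb c) = 0 by apply: Finj => //; rewrite y0.
    have /relx [v vE] : comb (c - col_mx (\col_j a j) 0) = 0.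
      rewrite addrC -scaleN1r combP aE scaleN1r addrC; apply/eqP.
      rewrite subr_eq0 /comb big_split_ord /= [X in _ == _ + X]big1 ?addr0.
        by apply/eqP/eq_bigr => j _; rewrite col_mxEu mxE.
      by move=> j _; rewrite col_mxEd mxE scale0r.
    have -> : dsubmx c = dsubmx (phi *m v) by rewrite -vE linearB /= col_mxKd subr0.
    exact: sm_phi.
  (* Modulo the first d generators, sigma times the combination is now a relation, so sigma kills
     its class; sigma cancels after the embedding of the quotient into the ring. *)
  have [v vE] := signed_minors_ker z0 sigmaP.
  have : p (comb (sigma *: c - colsub g phi *m v)) = 0.
    apply: comb_low; rewrite linearB linearZ /= vE; apply/eqP; rewrite subr_eq0; apply/eqP.
    by apply/matrixP => i j; rewrite !mxE; apply: eq_bigr => l _; rewrite !mxE.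
  rewrite -scaleN1r addrC combP (_ : comb (colsub g phi *m v) = 0).
    rewrite scaler0 add0r -[sigma *: c]addr0 combP.
    rewrite (_ : comb 0 = 0); last by rewrite /comb big1 // => j _; rewrite mxE scale0r.
    rewrite addr0 linearZ /= => pc0; apply: nzsigma.
    by have := FP sigma (p (comb c)) 0; rewrite !addr0 F0 addr0 pc0 F0.
  by rewrite -[phi]mulmx1 -mulmx_colsub -mulmxA comb_phi.
Qed.

Lemma minors_norm_iso (R : comNzRingType) (E : lmodType R) e
    (f : {linear E -> 'rV[R]_e}) u s n k (x : 'I_n -> E) (rho : 'M[R]_(n, k))
    (Q : comAlgType R) (N : Q -> Prop) :
  rank_splitting f u s -> n = (e + k)%N -> (forall v, fam_span x v) ->
  (forall l, \sum_i rho i l *: x i = 0) ->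
  (exists2 sigma, nonzerodivisor sigma & minors_ideal k rho sigma) ->
  total_ring_of_fractions Q -> is_norm E e N ->
  @submod_iso R R^o Q (minors_ideal k rho) N.
Proof.
move=> split_fu nE x_gen rho0 [sigma nzsigma sigmaP] fracQ normN.
have [nzs _ _] := split_fu; have nzse := nonzerodivisorX (n := e) nzs.
have [beta [rhoP Prho]] := relation_minors_complement split_fu x_gen nE rho0.
(* beta divides s^e sigma. *)
have nzbeta : nonzerodivisor beta.
  have [d _ sd] := rhoP _ sigmaP; apply: (@nonzerodivisor_divl _ _ d).
  by rewrite -sd; apply: nonzerodivisorM.
have [c nzc NE] := norm_minors split_fu x_gen fracQ normN.
have inj_c d : d *: c = 0 -> d = 0.
  move=> dc0; apply: (fractions_inj fracQ); rewrite rmorph0; apply: nzc.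
  by rewrite /= -scalerAr mulr1.
apply: (@submod_iso_rel R R^o Q _ _
  (fun y z => exists d, [/\ minors_ideal e (coord_mx f x) d, s ^+ e * y = beta * d & z = d *: c])).
- exact: minors_ideal_submodule.
- move=> y /rhoP [d dP yd]; exists (d *: c); last by exists d.
  by apply/NE; exists d.
- by move=> z /NE [d dP ->]; have [y yP yd] := Prho _ dP; exists y => //; exists d.
- move=> a y1 z1 y2 z2 [d1 [d1P E1 ->]] [d2 [d2P E2 ->]]; exists (a * d1 + d2); split.
  + by case: (minors_ideal_submodule e (coord_mx f x)) => _; apply.
  + rewrite [a *: _ + _]/(a * y1 + y2) mulrDr mulrCA E1 E2; ring.
  + by rewrite scalerDl scalerA.
- move=> y z [d [dP yd ->]]; split=> [y0|/inj_c d0].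
    have -> : d = 0 by apply: nzbeta; rewrite -yd y0 mulr0.
    by rewrite scale0r.
  by apply: nzse; rewrite yd d0 mulr0.
Qed.

(** The map f of the order determinant need not be the f0 of the splitting, but s0^e det f(v) = det
    f0(v) det f(u0). With c0 relating D to the minors of f, this yields s y' = delta d over R'',
    where s and delta are non-zero-divisors. *)
Lemma norm_order_determinant_iso (R R2 : comNzRingType) (nu : {rmorphism R -> R2})
    (E : lmodType R) (E2 : lmodType R2) (b : {linear E -> E2 | nu \; *:%R}) e
    (f : {linear E -> 'rV[R]_e}) (D : R -> Prop) (Q2 : comAlgType R2) (N : Q2 -> Prop) :
  (forall s, nonzerodivisor s -> nonzerodivisor (nu s)) ->
  is_base_change b -> finitely_generated E -> has_rank E e ->
  total_ring_of_fractions Q2 -> is_norm E2 e N -> is_order_determinant f D ->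
  @submod_iso R2 Q2 R2^o N (ext_ideal nu D).
Proof.
move=> nu_nz bcb fgE rankE fracQ normN ordD.
have [f0 [u0 [s0 split0]]] := has_rank_splitting fgE rankE.
have [p [y y_gen]] := fgE; have y2_gen := base_change_gen bcb y_gen.
have [f2 split2 f2E] := base_change_splitting bcb nu_nz split0.
have coordE := base_change_coord_mx y f2E.
have [c nzc NE] := norm_minors split2 y2_gen fracQ normN.
have [c0 nzc0 DE] := order_determinant_minors y_gen ordD.
have nzdelta : nonzerodivisor (nu (c0 * det_form f u0)).
  apply/nu_nz/nonzerodivisorM => //; case: ordD => rankf _.
  exact: image_rank_det_form fgE split0 rankf.
have [nzs0 _ _] := split0.
have nzs : nonzerodivisor (nu (s0 ^+ e)) by apply/nu_nz/nonzerodivisorX.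
set delta := nu _ in nzdelta; set s := nu _ in nzs.
have detE (h : 'I_e -> 'I_p) : s * nu (c0 * \det (colsub h (coord_mx f y))) =
    delta * \det (colsub h (coord_mx f2 (b \o y))).
  rewrite coordE -map_mxsub det_map_mx -!rmorphM !colsub_coord_mx !det_coord_mx.
  have := splitting_alternating split0 (finfun (y \o h)) (det_form_alternating f).
  have finE (h' : {linear E -> 'rV[R]_e}) w : det_form h' (finfun w) = det_form h' w.
    by congr (\det _); apply/matrixP => i j; rewrite !mxE ffunE.
  rewrite !finE => E1; congr (nu _).
  by rewrite mulrCA -mulrA; congr (_ * _); rewrite [RHS]mulrC; apply: E1.
have inj_c d : d *: c = 0 -> d = 0.
  move=> dc0; apply: (fractions_inj fracQ); rewrite rmorph0; apply: nzc.
  by rewrite /= -scalerAr mulr1.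
have extD y' : ext_ideal nu D y' ->
    exists2 d, minors_ideal e (coord_mx f2 (b \o y)) d & s * y' = delta * d.
  have idT : is_ideal (fun y' => exists2 d,
      minors_ideal e (coord_mx f2 (b \o y)) d & s * y' = delta * d).
    apply: is_ideal_intro => [|a y1 y2 [d1 d1P eq1] [d2 d2P eq2]].
      by exists 0; rewrite ?mulr0 //; case: (minors_ideal_submodule e (coord_mx f2 (b \o y))).
    exists (a * d1 + d2); last by rewrite !mulrDr ![_ * (a * _)]mulrCA eq1 eq2.
    by case: (minors_ideal_submodule e (coord_mx f2 (b \o y))) => _; apply.
  apply: (@lspan_min R2 R2^o _ _ idT) => _ [z /DE [d dP ->] ->]; move: d dP.
  apply: minors_ideal_min_cols => [|h].
    apply: is_ideal_intro => [|a d1 d2 P1 P2].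
      by rewrite mulr0 rmorph0; apply: idT.1.
    by rewrite mulrDr mulrCA rmorphD (rmorphM nu a); apply: (idT.2 (nu a) _ _ P1 P2).
  exists (\det (colsub h (coord_mx f2 (b \o y)))); last exact: detE.
  exact: (minors_ideal_mem _ id h).
have Dext d : minors_ideal e (coord_mx f2 (b \o y)) d ->
    exists2 y', ext_ideal nu D y' & s * y' = delta * d.
  have [D0 Dlin] : is_ideal (ext_ideal nu D) by exact: lspan_submodule.
  move: d; apply: minors_ideal_min_cols => [|h].
    apply: is_ideal_intro => [|a d1 d2 [y1 y1P eq1] [y2 y2P eq2]].
      by exists 0; rewrite ?mulr0.
    exists (a * y1 + y2); last by rewrite !mulrDr ![_ * (a * _)]mulrCA eq1 eq2.
    exact: Dlin.
  exists (nu (c0 * \det (colsub h (coord_mx f y)))); last exact: detE.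
  apply: (@lspan_mem R2 R2^o); exists (c0 * \det (colsub h (coord_mx f y))) => //.
  by apply/DE; exists (\det (colsub h (coord_mx f y))) => //; exact: (minors_ideal_mem _ id h).
apply: (@submod_iso_rel R2 Q2 R2^o _ _ (fun z y' => exists d,
  [/\ minors_ideal e (coord_mx f2 (b \o y)) d, z = d *: c & s * y' = delta * d])).
- have [P0 Plin] := minors_ideal_submodule e (coord_mx f2 (b \o y)).
  split=> [|a z1 z2 /NE [d1 P1 ->] /NE [d2 P2 ->]]; apply/NE.
    by exists 0; rewrite ?scale0r.
  by exists (a * d1 + d2); [exact: Plin | rewrite scalerDl scalerA].
- by move=> z /NE [d dP ->]; have [y' y'P eq1] := Dext _ dP; exists y' => //; exists d.
- move=> y' /extD [d dP eq1]; exists (d *: c); last by exists d.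
  by apply/NE; exists d.
- move=> a z1 y1 z2 y2 [d1 [P1 -> eq1]] [d2 [P2 -> eq2]]; exists (a * d1 + d2); split.
  + by case: (minors_ideal_submodule e (coord_mx f2 (b \o y))) => _; apply.
  + by rewrite scalerDl scalerA.
  + by rewrite [a *: _ + _]/(a * y1 + y2) !mulrDr ![_ * (a * _)]mulrCA eq1 eq2.
- move=> z y' [d [dP -> eq1]]; split=> [/inj_c d0|y0].
    by apply: nzs; rewrite eq1 d0 mulr0.
  have -> : d = 0 by apply: nzdelta; rewrite -eq1 y0 mulr0.
  by rewrite scale0r.
Qed.

(** * Counting the columns, and the theorem *)

(** If [phi] had more than k columns, the McCoy step with y = 1 would make its k-minors vanish along
    with the (k+1)-minors, and sigma with them. *)
Lemma injective_columns_bij (R : comNzRingType) p q k (phi : 'M[R]_(p, q))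
    (g : 'I_k -> 'I_q) :
  (forall v : 'cV_q, phi *m v = 0 -> v = 0) ->
  (forall (f : 'I_k.+1 -> 'I_p) (h : 'I_k.+1 -> 'I_q), \det (mxsub f h phi) = 0) ->
  injective g -> (exists2 sigma, nonzerodivisor sigma & minors_ideal k (colsub g phi) sigma) ->
  bijective g.
Proof.
move=> phi_inj minor0 g_inj [sigma nzsigma sigmaP]; apply: inj_card_bij => //.
rewrite !card_ord leqNgt; apply/negP => lt_kq.
suff sigma0 : sigma = 0 by apply: (@nonzerodivisor_neq0 R); rewrite -sigma0.
move: sigma sigmaP {nzsigma}; apply: minors_ideal_min.
  by apply: is_ideal_intro => // c y1 y2 -> ->; rewrite mulr0 addr0.
move=> f h; have := mccoy_step phi_inj lt_kq (y := 1) _ f (g \o h).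
rewrite mul1r (_ : mxsub f h _ = mxsub f (g \o h) phi) => [|]; last first.
  by apply/matrixP => i j; rewrite !mxE.
by apply=> f' h'; rewrite mul1r.
Qed.

Lemma bijective_columns_presentation (R : comNzRingType) (E : lmodType R) p q k
    (x : 'I_p -> E) (phi : 'M[R]_(p, q)) (g : 'I_k -> 'I_q) :
  bijective g -> is_presentation x phi -> is_presentation x (colsub g phi).
Proof.
move=> [g' gK g'K] [x_gen relx]; split=> // c; rewrite relx.
split=> [] [v ->]; [exists (rowsub g v) | exists (rowsub g' v)]; apply/matrixP => i j; rewrite !mxE.
  rewrite (reindex g) /=; last by exists g' => l _.
  by apply: eq_bigr => l _; rewrite !mxE.
rewrite [RHS](reindex g) /=; last by exists g' => l _.
by apply: eq_bigr => l _; rewrite !mxE gK.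
Qed.

(* The number of generators of E'' is n = e + k, written e.-1 + k.+1 so that
   rows e, ..., n of a matrix are its lower block. *)
Theorem proposition6p2
  (R : comNzRingType) (m : R -> Prop)
  (noethR : noetherian R) (localR : local_ring m)
  (E : lmodType R) (fgE : finitely_generated E)
  (e : nat) (e_ge2 : (2 <= e)%N) (rankE : has_rank E e)
  (r : nat) (a : 'I_r -> E) (redU : is_reduction (fam_span a))
  (R2 : comNzRingType) (iota : {rmorphism {mpoly R[r * e.-1]} -> R2})
  (nagR2 : is_nagata_extension m iota)
  (E2 : lmodType R2) (b : {linear E -> E2 | nagata_incl iota \; *:%R})
  (bcE2 : is_base_change b)
  (k q : nat) (x : 'I_(e.-1 + k.+1) -> E2) (phi : 'M[R2]_(e.-1 + k.+1, q))
  (x_gen : forall j : 'I_e.-1,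
     x (lshift k.+1 j) = generic_element a iota b j)
  (pres_phi : is_presentation x phi)
  (g : 'I_k -> 'I_q) (g_inj : injective g) :
  let rho : 'M[R2]_(e.-1 + k.+1, k) := colsub g phi in
  let psi : 'M[R2]_(k.+1, k) := dsubmx rho in
  grade_ge (minors_ideal k psi) 1 ->
  grade_ge (fitting_ideal E e) 2 ->
  [/\ forall I : R2 -> Prop,
        is_bourbaki_ideal (generic_element a iota b) I ->
        @submod_iso R2 R2^o R2^o I (minors_ideal k psi),
      subset_of (minors_ideal k psi) (minors_ideal k rho),
      subset_of (minors_ideal k rho) (fitting_ideal E2 e),
      forall (Q2 : comAlgType R2) (N : Q2 -> Prop),
        total_ring_of_fractions Q2 -> is_norm E2 e N ->
        @submod_iso R2 R2^o Q2 (minors_ideal k rho) N /\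
        forall (f : {linear E -> 'rV[R]_e}) (D : R -> Prop),
          is_order_determinant f D ->
          @submod_iso R2 Q2 R2^o N (ext_ideal (nagata_incl iota) D)
    & projdim_eq E 1 -> minimal_columns phi ->
        forall y : R2, minors_ideal k rho y <-> fitting_ideal E2 e y].
Proof.
move=> rho psi grade_psi _.
have [max_m _] := localR; have [sigma nzsigma sigma_psi] := grade1_nonzerodivisor grade_psi.
have e_gt0 : (0 < e)%N by apply: ltnW.
(* One size in two shapes: e-1 and k+1 rows cut out [psi], while e and k are the sizes of
   complementary minors. *)
have nE : (e.-1 + k.+1)%N = (e + k)%N by rewrite addnS -addSn prednK.
have nu_nz := nagata_incl_nonzerodivisor nagR2.
have [f0 [u0 [s0 split0]]] := has_rank_splitting fgE rankE.
have [f2 split2 f2E] := base_change_splitting bcE2 nu_nz split0.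
have rel_rho l : \sum_i rho i l *: x i = 0.
  rewrite -[RHS](presentation_relation (g l) pres_phi).
  by apply: eq_bigr => i _; rewrite mxE.
have psi_rho : subset_of (minors_ideal k psi) (minors_ideal k rho).
  apply: minors_ideal_min_rows => [|h]; first exact: minors_ideal_submodule.
  rewrite (_ : rowsub h psi = mxsub (fun i => rshift _ (h i)) id rho).
    exact: minors_ideal_mem.
  by apply/matrixP => i j; rewrite !mxE.
have rho_nz : exists2 sigma, nonzerodivisor sigma & minors_ideal k rho sigma.
  by exists sigma => //; apply: psi_rho.
have rho_fitting : subset_of (minors_ideal k rho) (fitting_ideal E2 e).
  move=> y yP; exists (e.-1 + k.+1)%N, q, x, phi; split=> //.
  have -> : (e.-1 + k.+1 - e)%N = k by rewrite nE addKn.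
  move: y yP; apply: minors_ideal_min_rows => [|h]; first exact: minors_ideal_submodule.
  rewrite (_ : rowsub h rho = mxsub h g phi); first exact: minors_ideal_mem.
  by apply/matrixP => i j; rewrite !mxE.
split=> // [I bourI|Q2 N fracQ2 normN|[pd1 _] min_phi y].
- apply: (bourbaki_ideal_iso split2 _ pres_phi nzsigma sigma_psi).
    by rewrite prednK.
  case: bourI => freeI idI [C [p [p_surj p_ker isoI]]].
  have xE : (fun j => x (lshift k.+1 j)) = generic_element a iota b by apply/funext.
  by rewrite xE; split=> //; exists C, p; split.
- split=> [|f D ordD].
    exact: minors_norm_iso split2 nE pres_phi.1 rel_rho rho_nz fracQ2 normN.
  exact: norm_order_determinant_iso nu_nz bcE2 fgE rankE fracQ2 normN ordD.
split=> [/rho_fitting //|yF].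
(* The projective dimension is given over R: the splitting is found there, extended to R'' by
   flatness, then carried to [phi]. *)
have [p [q0 [y0 [A presA]]]] := noetherian_presentation noethR fgE.
have [eps [Aeps epsA]] := projdim1_split_columns presA pd1.
have [eps2 split_phi] : exists eps2, split_columns phi eps2.
  apply: (split_columns_transport pres_phi (base_change_presentation bcE2 presA)).
  split; last exact: (nagata_incl_flat max_m nagR2 epsA).
  by rewrite -map_mxM Aeps.
have phi_inj := minimal_split_columns_inj (nagata_nonunit_ideal max_m nagR2) min_phi split_phi.
have g_bij : bijective g.
  apply: (injective_columns_bij phi_inj _ g_inj rho_nz) => f h.
  rewrite (_ : mxsub f h phi = rowsub f (colsub h phi)); last first.
    by apply/matrixP => i j; rewrite !mxE.
  apply: (relation_minors_eq0 split2 pres_phi.1); first by rewrite nE addnS.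
  move=> l; rewrite -[RHS](presentation_relation (h l) pres_phi).
  by apply: eq_bigr => i _; rewrite mxE.
exact: fitting_ideal_minors split2 nE (bijective_columns_presentation g_bij pres_phi) yF.
Qed.
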